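(* Let $k\ge 2$ and let $G_1,\dots,G_k$ be finite connected graphs such that for no $i\neq j$ is $G_i$ isomorphic to a subgraph of $G_j$; let $A=\bigsqcup_{i=1}^kG_i$. Then there exists a tree-like gluing $H_A$ of $G_1,\dots,G_k$ with $H_A$ not isomorphic to any $G_i$, and for every constant $p\in(0,1)$ and every integer $q>1$, the distribution of $N(A)$ modulo $q$ in $G(n,p)$ is $2^{-\Omega(n)}$-close to uniform on $\mathbb{Z}_q$.
   Context: A \emph{gluing} of connected graphs $G_1,\dots,G_k$ is a connected graph $H$ with subgraphs $H_1,\dots,H_k$ such that $H_i\cong G_i$, $\bigcup V(H_i)=V(H)$, $\bigcup E(H_i)=E(H)$ (a \emph{decomposition}); $H$ is \emph{uniquely decomposable} if it has exactly one decomposition. The \emph{structure graph} $T(H)$ of a uniquely decomposable $H$ has vertex set $[k]$ and an edge $\{i,j\}$ whenever $H_i$ and $H_j$ share a vertex; $H$ is \emph{tree-like} if uniquely decomposable and $T(H)$ is a tree. $N(A)$ is the number of (not necessarily induced) subgraphs of $G(n,p)$ isomorphic to $A$; ''$2^{-\Omega(n)}$-close'' means total variation distance at most $2^{-cn}$ for some constant $c>0$ and all large $n$. *)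

(* Defs.v *)
From Stdlib Require Import Reals.
From mathcomp Require Import all_boot.
Set Implicit Arguments. Unset Strict Implicit. Unset Printing Implicit Defensive.

Record graph := Graph { vert : finType; adj : rel vert }.
Arguments adj {g}.

Definition simple (G : graph) : Prop :=
  symmetric (@adj G) /\ irreflexive (@adj G).

Definition gconnected (G : graph) : Prop :=
  (0 < #|vert G|)%N /\ forall x y : vert G, connect (@adj G) x y.

Definition giso (G H : graph) : Prop :=
  exists f : vert G -> vert H, bijective f /\ forall x y, adj x y = adj (f x) (f y).

(* a (not necessarily induced) subgraph of H: a vertex set and a symmetric
   edge set (edges as ordered pairs, both orientations present) *)
Definition subg_t (H : graph) := ({set vert H} * {set vert H * vert H})%type.

Definition is_subgraph (H : graph) (s : subg_t H) : bool :=
  [forall x, forall y, ((x, y) \in s.2) ==>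
     [&& adj x y, x \in s.1, y \in s.1 & (y, x) \in s.2]].

Definition sub_iso (G H : graph) (s : subg_t H) : bool :=
  [exists f : {ffun vert G -> vert H},
     [&& injectiveb f, f @: setT == s.1 &
         [forall x, forall y, adj x y == ((f x, f y) \in s.2)]]].

Definition iso_to_subgraph (G H : graph) : Prop :=
  exists s : subg_t H, is_subgraph s && sub_iso G s.

Definition edge_set (H : graph) : {set vert H * vert H} :=
  [set e | adj e.1 e.2].

Definition decomp (k : nat) (Gs : 'I_k -> graph) (H : graph)
    (D : {ffun 'I_k -> subg_t H}) : Prop :=
  [/\ forall i, is_subgraph (D i) && sub_iso (Gs i) (D i),
      \bigcup_(i < k) (D i).1 = setT &
      \bigcup_(i < k) (D i).2 = edge_set H].

Definition gluing (k : nat) (Gs : 'I_k -> graph) (H : graph) : Prop :=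
  simple H /\ gconnected H /\ exists D : {ffun 'I_k -> subg_t H}, decomp Gs D.

Definition uniquely_decomposable k (Gs : 'I_k -> graph) (H : graph) : Prop :=
  exists D : {ffun 'I_k -> subg_t H}, decomp Gs D /\ forall D', decomp Gs D' -> D' = D.

Definition struct_rel k (H : graph) (D : {ffun 'I_k -> subg_t H}) : rel 'I_k :=
  fun i j => (i != j) && ((D i).1 :&: (D j).1 != set0).

Definition is_tree (T : finType) (e : rel T) : Prop :=
  (0 < #|T|)%N /\ (forall x y : T, connect e x y) /\
  ~ (exists s : seq T, [&& uniq s, (2 < size s)%N & cycle e s]).

Definition tree_like k (Gs : 'I_k -> graph) (H : graph) : Prop :=
  gluing Gs H /\
  exists D : {ffun 'I_k -> subg_t H}, [/\ decomp Gs D, (forall D', decomp Gs D' -> D' = D) &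
               is_tree (struct_rel D)].

Definition disj_union k (Gs : 'I_k -> graph) : graph :=
  @Graph {i : 'I_k & vert (Gs i)}
    (fun u v => (tag u == tag v) && adj (tagged u) (tagged_as u v)).

Definition countN (A H : graph) : nat :=
  #|[set s : subg_t H | is_subgraph s && sub_iso A s]|.

(* G(n,p): vertex set 'I_n; an outcome is a set E of pairs (i,j) with i<j *)
Definition upper (n : nat) : {set 'I_n * 'I_n} := [set e : 'I_n * 'I_n | (e.1 < e.2)%N].

Definition gnp_graph (n : nat) (E : {set 'I_n * 'I_n}) : graph :=
  @Graph 'I_n (fun x y => ((x, y) \in E) || ((y, x) \in E)).

Open Scope R_scope.

Definition gnp_weight (n : nat) (p : R) (E : {set 'I_n * 'I_n}) : R :=
  pow p #|E| * pow (1 - p) (#|upper n| - #|E|).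

Definition prob_mod (A : graph) (n : nat) (p : R) (q r : nat) : R :=
  \big[Rplus/0]_(E in powerset (upper n) | (countN A (gnp_graph E) %% q == r)%N)
     gnp_weight p E.

Definition tv_mod_uniform (A : graph) (n : nat) (p : R) (q : nat) : R :=
  / 2 * \big[Rplus/0]_(r < q) Rabs (prob_mod A n p q r - / INR q).

Close Scope R_scope.

(* Main.v *)
(** Every connected graph has a vertex [v] whose removal leaves it connected.
Glue [G_1, ..., G_k] along a path, identifying such a vertex [v_i] of [G_i] with
a vertex [z_(i+1) <> v_(i+1)] of [G_(i+1)].  Counting vertices shows that the
pieces of any decomposition of the result pairwise share at most one vertex; a
decomposition that split the piece [G_i] would therefore disconnect [G_i - v_i],
so, peeling the pieces off one by one, the decomposition is unique.

For the second part take [r = n / |H|] disjoint copies of the gluing [H] inside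
[n] vertices and let [B_c] consist of the [r] copies of the edge [c] of [H].
With [d = e(H)], Cauchy-Schwarz over each of the [d] classes gives
[|E z^N|^(2^d) <= |E z^Q|], where only the copies of the disjoint union meeting
every class contribute to [Q].  By unique decomposability these are given by
choosing, for each piece, one of the [r] copies of [H], with different choices
for consecutive pieces; so [Q = sum_f prod_i P_i(f_i)] over the proper colourings
[f] of a path.  [Q] is affine in the increments of the last piece, with
coefficients depending, for each copy of [H] separately, on that copy and on
[k - 1] global partial sums.  A union bound over the residues of these sums
makes the copies independent, and [E z^Q] is exponentially small in [r]. *)

Require Import Defs.
From Stdlib Require Import Reals Lra.
From HB Require Import structures.
From mathcomp Require Import all_boot zify.
Set Implicit Arguments. Unset Strict Implicit. Unset Printing Implicit Defensive.

(** * Subgraphs and decompositions *)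

(** In the first part the gluing has [sum |G_i| - (k - 1)] vertices, the largest number that a
    connected union of the pieces can have. Any further coincidence of vertices in some
    decomposition would leave too few of them.

    The obstacle in the second part is that [Q] is not a sum of independent terms: a copy of the
    disjoint union may spread its pieces over several copies of the gluing, so these all interact.
    They interact only through sums over all copies, and since [zeta ^ q = 1] only the residues of
    these sums matter. Conditioning on the sums would destroy independence; their possible residues
    are enumerated instead, at the cost of the constant factor [q ^ (k - 1)]. Grouping the edges
    into [d] classes keeps the exponent [2 ^ d] independent of [n], so the decay in [r] survives the
    root. Consecutive pieces need different copies because they share a vertex of [H], whereas other
    pieces are disjoint even inside one copy. *)

Lemma connect_ind (T : finType) (e : rel T) (P : T -> Prop) (x y : T) :
  connect e x y -> P x -> (forall a b, P a -> e a b -> P b) -> P y.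
Proof.
move=> /connectP[p + lst] Px IH; elim: p x Px lst => [|a p IHp] x Px /=; first by move=> ->.
by move=> lst /andP[exa pa]; apply: IHp pa => //; apply: IH Px exa.
Qed.

Definition avoid (G : graph) (v : vert G) : rel (vert G) :=
  fun a b => [&& adj a b, a != v & b != v].

(** Choose [v] so that the component of [z] in [G - v] is largest. If it missed some [x], then
    deleting [x] instead would keep this component and add [v] to it. The root [z] is returned too,
    because it becomes the vertex glued to the previous piece. *)
Lemma noncut_vertex (G : graph) : gconnected G -> (1 < #|vert G|)%N ->
  exists zv : vert G * vert G, zv.1 != zv.2 /\
    forall x, x != zv.2 -> connect (avoid zv.2) zv.1 x.
Proof.
move=> [_ conn] /card_gt1P[z [v0 [_ _ zv0]]].
have v0z : v0 != z by rewrite eq_sym.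
case: (@arg_maxnP _ v0 (fun v => v != z)
   (fun v => #|[set x | connect (avoid v) z x]|) v0z) => v vz maxv.
exists (z, v); split=> [|x /= xv]; first by rewrite /= eq_sym.
apply: contraT => nzx; have xz : x != z.
  by apply: contraNneq nzx => ->; exact: connect0.
have sub a : connect (avoid v) z a -> connect (avoid x) z a /\ a != x.
  move=> c; suff [] : connect (avoid v) z a /\ (connect (avoid x) z a /\ a != x) by [].
  pattern a; apply: (connect_ind c); first by rewrite !connect0 eq_sym xz.
  move=> b d [vb [xb bx]] ebd; have vd := connect_trans vb (connect1 ebd).
  have dx : d != x by apply: contraNneq nzx => <-.
  split=> //; split=> //; apply: (connect_trans xb (connect1 _)).
  by rewrite /avoid bx dx !andbT; case/and3P: ebd.
have nv a : connect (avoid v) z a -> a != v.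
  by move=> c; pattern a; apply: (connect_ind c) => [|b d _ /and3P[]//]; rewrite eq_sym in vz *.
have zv : connect (avoid x) z v.
  have [c|//] : connect (avoid v) z v \/ connect (avoid x) z v.
    pose Q a := connect (avoid v) z a \/ connect (avoid x) z v.
    apply: (@connect_ind _ _ Q _ _ (conn z v)); first by left; exact: connect0.
    move=> a b [za|]; last by right.
    move=> eab; have [xa ax] := sub _ za; have [bv|bv] := eqVneq b v; [subst b; right|left].
      by apply: (connect_trans xa (connect1 _)); rewrite /avoid eab ax eq_sym.
    by apply: (connect_trans za (connect1 _)); rewrite /avoid eab bv (nv _ za).
  by move: (nv _ c); rewrite eqxx.
have /maxv : x != z by [].
move=> /=; rewrite leqNgt => /negP; case; apply: proper_card; apply/properP; split.
  by apply/subsetP => a; rewrite !inE => /sub[].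
by exists v; rewrite !inE // ; apply/negP => /nv; rewrite eqxx.
Qed.

Lemma is_subgraphP (H : graph) (s : subg_t H) :
  reflect (forall x y, (x, y) \in s.2 ->
     [/\ adj x y, x \in s.1, y \in s.1 & (y, x) \in s.2]) (is_subgraph s).
Proof.
apply: (iffP forallP) => [h x y xy|h x].
  by have /forallP/(_ y)/implyP/(_ xy)/and4P[] := h x.
by apply/forallP => y; apply/implyP => /h[? ? ? ?]; apply/and4P.
Qed.

Lemma sub_isoP (G H : graph) (s : subg_t H) :
  reflect (exists f : vert G -> vert H, [/\ injective f, f @: setT = s.1 &
    forall x y, adj x y = ((f x, f y) \in s.2)]) (sub_iso G s).
Proof.
apply: (iffP existsP) => [[f /and3P[/injectiveP fi /eqP fs fa]]|[f [fi fs fa]]].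
  by exists f; split=> // x y; have /forallP/(_ x)/forallP/(_ y)/eqP := fa.
exists (finfun f); apply/and3P; split.
- by apply/injectiveP => x y; rewrite !ffunE => /fi.
- by apply/eqP; rewrite -fs; apply: eq_imset => x; rewrite ffunE.
- by apply/forallP => x; apply/forallP => y; rewrite !ffunE fa.
Qed.

Lemma sub_iso_card_vert (G H : graph) (s : subg_t H) : sub_iso G s -> #|s.1| = #|vert G|.
Proof. by case/sub_isoP => f [fi <- _]; rewrite card_imset // cardsT. Qed.

Lemma sub_iso_edges (G H : graph) (s : subg_t H) (f : vert G -> vert H) :
  is_subgraph s -> f @: setT = s.1 ->
  (forall x y, adj x y = ((f x, f y) \in s.2)) ->
  s.2 = [set (f e.1, f e.2) | e in edge_set G].
Proof.
move=> /is_subgraphP sg fs fa; apply/setP=> -[a b]; apply/idP/imsetP.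
  move=> ab; have [_] := sg _ _ ab; rewrite -fs => /imsetP[x _ ax] /imsetP[y _ by_] _.
  by exists (x, y); rewrite /= ?inE /= ?fa ?ax ?by_ -?ax -?by_.
by case=> [[x y]]; rewrite inE /= fa => ? [-> ->].
Qed.

Lemma sub_iso_card_edges (G H : graph) (s : subg_t H) :
  is_subgraph s -> sub_iso G s -> #|s.2| = #|edge_set G|.
Proof.
move=> sg /sub_isoP[f [fi fs fa]]; rewrite (sub_iso_edges sg fs fa) card_imset //.
by move=> [a b] [c d] /= [/fi-> /fi->].
Qed.

Lemma sub_iso_connect (G H : graph) (s : subg_t H) : gconnected G -> sub_iso G s ->
  forall x y, x \in s.1 -> y \in s.1 -> connect (fun a b => (a, b) \in s.2) x y.
Proof.
move=> [_ cG] /sub_isoP[f [_ fs fa]] x y; rewrite -fs => /imsetP[a _ ->] /imsetP[b _ ->].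
pattern b; apply: (connect_ind (cG a b)) => [|c d h]; first exact: connect0.
by rewrite fa => e; apply: (connect_trans h (connect1 e)).
Qed.

Lemma connected_has_edge (G : graph) : gconnected G -> (1 < #|vert G|)%N ->
  forall x : vert G, exists y, adj x y.
Proof.
move=> [_ cG] /card_gt1P[a [b [_ _ ab]]] x.
have [y xy] : exists y, x != y.
  by have [xa|?] := eqVneq x a; [exists b; rewrite xa|exists a].
have /connectP[[|c p] /= h lst] := cG x y; first by rewrite lst eqxx in xy.
by exists c; case/andP: h.
Qed.

Lemma sub_iso_has_edge (G H : graph) (s : subg_t H) :
  gconnected G -> (1 < #|vert G|)%N -> sub_iso G s ->
  forall x, x \in s.1 -> exists y, (x, y) \in s.2.
Proof.
move=> cG G1 /sub_isoP[f [_ fs fa]] x; rewrite -fs => /imsetP[a _ ->].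
by have [b ab] := connected_has_edge cG G1 a; exists (f b); rewrite -fa.
Qed.

Lemma sub_iso_sub1 (G H : graph) (s t : subg_t H) :
  gconnected G -> (1 < #|vert G|)%N -> sub_iso G s -> is_subgraph t ->
  s.2 \subset t.2 -> s.1 \subset t.1.
Proof.
move=> cG G1 sG /is_subgraphP tg /subsetP st; apply/subsetP=> x xs.
by have [y /st/tg[]] := sub_iso_has_edge cG G1 sG xs.
Qed.

(** Copies of one graph have equally many edges, so the inclusion is an equality; no vertex is
    isolated, so the edges determine the vertices. *)
Lemma sub_iso_eq (G H : graph) (s t : subg_t H) :
  gconnected G -> (1 < #|vert G|)%N -> sub_iso G s -> sub_iso G t ->
  is_subgraph s -> is_subgraph t -> s.2 \subset t.2 -> s = t.
Proof.
move=> cG G1 sG tG sg tg st.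
have e2 : s.2 = t.2.
  by apply/eqP; rewrite eqEcard st !(sub_iso_card_edges _ sG) // (sub_iso_card_edges _ tG) ?leqnn.
have e1 : s.1 = t.1.
  by apply/eqP; rewrite eqEsubset !(@sub_iso_sub1 G) // e2.
by case: s t e1 e2 {sG tG sg tg st} => [? ?] [? ?] /= -> ->.
Qed.

Lemma iso_to_subgraph_sub (G G' H : graph) (s t : subg_t H) :
  is_subgraph s -> sub_iso G s -> sub_iso G' t ->
  s.1 \subset t.1 -> s.2 \subset t.2 -> iso_to_subgraph G G'.
Proof.
move=> /is_subgraphP sg /sub_isoP[f [fi fs fa]] /sub_isoP[g [gi gs ga]] /subsetP s1 /subsetP s2.
have [h gh] : exists h : vert G -> vert G', forall x, g (h x) = f x.
  apply: (@fin_all_exists _ _ (fun x y => g y = f x)) => x; have /s1 : f x \in s.1 by rewrite -fs imset_f.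
  by rewrite -gs => /imsetP[y _ ->]; exists y.
have hi : injective h by move=> x y e; apply: fi; rewrite -!gh e.
exists (h @: setT, [set (h e.1, h e.2) | e in edge_set G]); apply/andP; split.
  apply/is_subgraphP => x y /imsetP[[a b] /= ]; rewrite inE /= => ab [-> ->].
  move: (ab); rewrite fa => /[dup] /s2 fab' /sg [_ _ _ ba].
  rewrite ga !gh fab' !imset_f //; split=> //.
  by apply/imsetP; exists (b, a); rewrite ?inE //= fa.
apply/sub_isoP; exists h; split=> // x y; apply/idP/imsetP => [xy|].
  by exists (x, y); rewrite ?inE.
by case=> [[a b]]; rewrite inE /= => ab [/hi-> /hi->].
Qed.

(** A single vertex embeds in every nonempty graph, and [2 <= k] provides another piece. *)
Lemma incomparable_card_gt1 (k : nat) (Gs : 'I_k -> graph) : (2 <= k)%N ->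
  (forall i, simple (Gs i)) -> (forall i, gconnected (Gs i)) ->
  (forall i j : 'I_k, i != j -> ~ iso_to_subgraph (Gs i) (Gs j)) ->
  forall i, (1 < #|vert (Gs i)|)%N.
Proof.
move=> k2 simp conn inc i; rewrite ltnNge; apply/negP => le1.
have /card_gt1P[a [b [_ _ ab]]] : (1 < #|'I_k|)%N by rewrite card_ord.
have [j ij] : exists j, i != j.
  by have [ia|?] := eqVneq i a; [exists b; rewrite ia|exists a].
apply: (inc i j ij); have [/card_gt0P[y _] _] := conn j.
have all_eq (x x' : vert (Gs i)) : x = x' by apply: (fintype_le1P le1).
have [/card_gt0P[x0 _] _] := conn i.
exists ([set y], set0); apply/andP; split.
  by apply/is_subgraphP => ? ?; rewrite inE.
apply/sub_isoP; exists (fun=> y); split=> //=.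
- apply/setP=> t; rewrite inE; apply/imsetP/eqP => [[_ _ ->//]|->]; by exists x0.
- by move=> x x'; rewrite inE (all_eq x' x); case: (simp i).
Qed.

(* Growing [J] from [{i, j}], each new piece meets the union already built, so an
   excess intersection at the start persists to the end. *)
Lemma hypertree_meet (T : finType) (k : nat) (V : 'I_k -> {set T}) :
  (forall J : {set 'I_k}, J != set0 -> J != setT ->
     exists2 m, m \notin J & V m :&: \bigcup_(i in J) V i != set0) ->
  \bigcup_i V i = setT -> \sum_i #|V i| < #|T| + k ->
  forall i j, i != j -> #|V i :&: V j| <= 1.
Proof.
move=> link cov lt i j ij; rewrite leqNgt; apply/negP => gt1.
pose P (J : {set 'I_k}) := [&& i \in J, j \in J &
   #|\bigcup_(l in J) V l| + #|J| <= \sum_(l in J) #|V l|].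
have P0 : P [set i; j].
  rewrite /P !inE !eqxx orbT /= cards2 ij !big_setU1 ?inE //= !big_set1.
  by have := cardsUI (V i) (V j); lia.
case: (@arg_maxnP _ _ P (fun J => #|J|) P0) => J /and3P[iJ jJ le] maxJ.
have [JT|JnT] := eqVneq J setT.
  move: le; rewrite JT cardsT card_ord.
  rewrite (eq_bigl xpredT) => [|l]; last by rewrite inE.
  rewrite cov cardsT (eq_bigl xpredT) => [|l]; last by rewrite inE.
  by rewrite leqNgt lt.
have [|m mJ mV] := link J _ JnT; first by apply/set0Pn; exists i.
suff /maxJ /= : P (m |: J) by rewrite cardsU1 mJ; lia.
rewrite /P !inE iJ jJ !orbT /= !big_setU1 //= cardsU1 mJ.
have := cardsUI (V m) (\bigcup_(l in J) V l); rewrite -card_gt0 in mV.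
move: mV le; set U := \bigcup_(l in J) V l.
move: #|V m :&: U| #|V m :|: U| #|V m| #|U| #|J| (\sum_(i0 in J) _) => *; lia.
Qed.

(** * Uniqueness of decompositions *)

Section Decomposition.
Variables (k : nat) (Gs : 'I_k -> graph) (H : graph).
Hypothesis Hconn : gconnected H.
Hypothesis conn : forall i, gconnected (Gs i).
Hypothesis gt1 : forall i, 1 < #|vert (Gs i)|.

Lemma decomp_edge (D : {ffun 'I_k -> subg_t H}) (x y : vert H) : decomp Gs D ->
  adj x y = [exists i, (x, y) \in (D i).2].
Proof.
case=> _ _ /setP/(_ (x, y)); rewrite inE /= => <-.
by apply/bigcupP/existsP => [[i _]|[i]]; exists i.
Qed.

(** Connectedness of [H] supplies the linking hypothesis: if no piece outside [J] met the union [W]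
    of the pieces in [J], then [W] would be closed under adjacency, hence everything, and each piece
    would meet it. *)
Lemma decomp_meet (D : {ffun 'I_k -> subg_t H}) : decomp Gs D ->
  \sum_i #|vert (Gs i)| < #|vert H| + k ->
  forall i j, i != j -> #|(D i).1 :&: (D j).1| <= 1.
Proof.
move=> dD lt; have [sD cov _] := dD; apply: hypertree_meet => //; last first.
  rewrite (eq_bigr (fun i => #|vert (Gs i)|)) // => i _.
  by case/andP: (sD i) => _ /sub_iso_card_vert.
move=> J J0 JT; apply/exists_inP; apply: contraT => /exists_inPn no.
set W := \bigcup_(i in J) (D i).1 in no.
have ne i : exists x, x \in (D i).1.
  have /andP[_ /sub_iso_card_vert c] := sD i.
  by apply/card_gt0P; rewrite c; apply: ltnW.
have noW m x : x \in (D m).1 -> x \in W -> m \in J.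
  move=> xm xW; apply: contraT => /no; rewrite negbK => /eqP/setP/(_ x).
  by rewrite !inE xm xW.
have [i iJ] := set0Pn _ J0; have [x xi] := ne i.
have xW : x \in W by apply/bigcupP; exists i.
have WT y : y \in W.
  have [_ /(_ x y) c] := Hconn; pattern y; apply: (connect_ind c) => // a b aW.
  rewrite (decomp_edge _ _ dD) => /existsP[m abm].
  have /andP[/is_subgraphP/(_ _ _ abm)[_ am bm _] _] := sD m.
  by apply/bigcupP; exists m => //; apply: noW am aW.
case/negP: JT; apply/eqP/setP => m; rewrite inE.
by have [y ym] := ne m; apply: noW ym (WT y).
Qed.

Section Unique.
Variables (D D' : {ffun 'I_k -> subg_t H}) (w : 'I_k -> vert H).
Hypothesis Hsimp : simple H.
Hypothesis inc : forall i j, i != j -> ~ iso_to_subgraph (Gs i) (Gs j).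
Hypothesis card : \sum_i #|vert (Gs i)| < #|vert H| + k.
Hypotheses (dD : decomp Gs D) (dD' : decomp Gs D').
Hypothesis meet : forall (i j : 'I_k) x, i < j -> x \in (D i).1 -> x \in (D j).1 -> x = w i.
Hypothesis noncut : forall i x y, x \in (D i).1 -> y \in (D i).1 -> x != w i -> y != w i ->
  connect (fun a b => [&& (a, b) \in (D i).2, a != w i & b != w i]) x y.

(** A common edge means two common vertices, since [H] has no loops. *)
Lemma decomp_edge_disjoint (E : {ffun 'I_k -> subg_t H}) i j x y : decomp Gs E ->
  (x, y) \in (E i).2 -> (x, y) \in (E j).2 -> i = j.
Proof.
move=> dE xi xj; apply/eqP; apply: contraT => ij; have [sE _ _] := dE.
have /andP[/is_subgraphP/(_ _ _ xi)[axy xi1 yi1 _] _] := sE i.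
have /andP[/is_subgraphP/(_ _ _ xj)[_ xj1 yj1 _] _] := sE j.
have /card_le1_eqP/(_ x y) e := decomp_meet dE card ij.
have xy : x = y by apply/esym/e; rewrite inE ?xi1 ?xj1 ?yi1 ?yj1.
by move: axy; rewrite xy (Hsimp.2 y).
Qed.

(** Incomparability is used twice: a piece of [D'] lying inside [D i], or containing [D i], must be
    [D' i], and then equals it. If none lies inside, all pieces of [D'] that share an edge with
    [D i] pass through [w i] and are disjoint elsewhere. Since [D i] minus [w i] is connected, a
    single one of them contains all of [D i]. *)
Lemma piece_step (i : 'I_k) : (forall j : 'I_k, j < i -> D' j = D j) -> D' i = D i.
Proof.
move=> IH; have [sD covD _] := dD; have [sD' covD' _] := dD'.
have sg j : is_subgraph (D j) by case/andP: (sD j).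
have si j : sub_iso (Gs j) (D j) by case/andP: (sD j).
have sg' j : is_subgraph (D' j) by case/andP: (sD' j).
have si' j : sub_iso (Gs j) (D' j) by case/andP: (sD' j).
have vD j x y : (x, y) \in (D j).2 -> x \in (D j).1 /\ y \in (D j).1.
  by move/is_subgraphP: (sg j) => h /h[].
have vD' j x y : (x, y) \in (D' j).2 -> x \in (D' j).1 /\ y \in (D' j).1.
  by move/is_subgraphP: (sg' j) => h /h[].
have inD x y : adj x y -> exists m, (x, y) \in (D m).2.
  by rewrite (decomp_edge _ _ dD) => /existsP.
have inD' x y : adj x y -> exists m, (x, y) \in (D' m).2.
  by rewrite (decomp_edge _ _ dD') => /existsP.
have adjD j x y : (x, y) \in (D j).2 -> adj x y.
  by move/is_subgraphP: (sg j) => h /h[].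
have adjD' j x y : (x, y) \in (D' j).2 -> adj x y.
  by move/is_subgraphP: (sg' j) => h /h[].
have ge j x y : (x, y) \in (D i).2 -> (x, y) \in (D' j).2 -> i <= j.
  move=> xi xj; rewrite leqNgt; apply/negP => ji; move: xj; rewrite IH // => xj.
  by move: ji; rewrite (decomp_edge_disjoint dD xi xj) ltnn.
have [/existsP[j /andP[jE /set0Pn[[x0 y0] /setIP[e0 e0']]]]|none] :=
  boolP [exists j, ((D' j).2 \subset (D i).2) &&
    ((D' j).2 :&: (D i).2 != set0)].
  have ji : j = i.
    apply/eqP; apply: contraT => /inc; case; apply: (iso_to_subgraph_sub (sg' j) (si' j) (si i) _ jE).
    exact: sub_iso_sub1 (si' j) (sg i) jE.
  by rewrite ji in jE; apply: sub_iso_eq (si' i) (si i) (sg' i) (sg i) jE.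
(* every piece of [D'] meeting [D i] in an edge leaves [D i], hence passes through [w i] *)
have thru j x y : (x, y) \in (D i).2 -> (x, y) \in (D' j).2 -> w i \in (D' j).1.
  move=> xi xj; apply: contraT => wj.
  have ij := ge _ _ _ xi xj.
  have hi a b m : (a, b) \in (D' j).2 -> (a, b) \in (D m).2 -> i <= m.
    move=> abj abm; rewrite leqNgt; apply/negP => mi; move: (mi); rewrite -(IH _ mi) in abm.
    by rewrite -(decomp_edge_disjoint dD' abj abm) ltnNge ij.
  (* A walk inside [D' j] can leave [D i] only into a later piece, hence only at [w i], which [D' j]
     misses. *)
  have stay a : a \in (D' j).1 -> a \in (D i).1.
    have [xj1 _] := vD' _ _ _ xj; have [xi1 _] := vD _ _ _ xi.
    move=> aj; pattern a; apply: (connect_ind (sub_iso_connect (conn j) (si' j) xj1 aj)) => //.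
    move=> b c bi bc; have [m bcm] := inD _ _ (adjD' _ _ _ bc).
    have [bm cm] := vD _ _ _ bcm; have := hi _ _ _ bc bcm; rewrite leq_eqVlt.
    case/orP=> [/eqP/val_inj -> //|im]; have bw := meet im bi bm.
    by have [] := vD' _ _ _ bc; rewrite bw (negPf wj).
  case/negP: none; apply/existsP; exists j; apply/andP; split; last first.
    by apply/set0Pn; exists (x, y); rewrite inE xi xj.
  apply/subsetP=> -[a b] ab; have [m abm] := inD _ _ (adjD' _ _ _ ab).
  have := hi _ _ _ ab abm; rewrite leq_eqVlt => /orP[/eqP/val_inj -> //|im].
  have [am _] := vD _ _ _ abm; have [aj _] := vD' _ _ _ ab.
  by move: wj; rewrite -(meet im (stay _ aj) am) aj.
(* Two pieces through [w i] already share that vertex, and [decomp_meet] allows no second one. *)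
have uniq_j j j' x : w i \in (D' j).1 -> w i \in (D' j').1 -> x != w i ->
    x \in (D' j).1 -> x \in (D' j').1 -> j = j'.
  move=> wj wj' xw xj xj'; apply/eqP; apply: contraT => jj'.
  have /card_le1_eqP/(_ x (w i)) e := decomp_meet dD' card jj'.
  by case/eqP: xw; apply/esym/e; rewrite inE ?xj ?wj ?xj'.
have [x0 [x0i x0w]] : exists x0, x0 \in (D i).1 /\ x0 != w i.
  have := gt1 i; rewrite -(sub_iso_card_vert (si i)) => /card_gt1P[a [b [ai bi ab]]].
  by have [aw|?] := eqVneq a (w i); [exists b; rewrite -aw eq_sym|exists a].
have [y0 e0] := sub_iso_has_edge (conn i) (gt1 i) (si i) x0i.
have [j0 e0'] := inD' _ _ (adjD _ _ _ e0).
have wj0 := thru _ _ _ e0 e0'; have [x0j0 _] := vD' _ _ _ e0'.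
have next x y : x \in (D' j0).1 -> x != w i -> (x, y) \in (D i).2 -> (x, y) \in (D' j0).2.
  move=> xj0 xw xy; have [j xyj] := inD' _ _ (adjD _ _ _ xy).
  have [xj _] := vD' _ _ _ xyj.
  by rewrite (uniq_j j0 j x) // (thru _ _ _ xy xyj).
have all_in x : x \in (D i).1 -> x != w i -> x \in (D' j0).1.
  move=> xi xw; suff [] : x \in (D' j0).1 /\ x != w i by [].
  pattern x; apply: (connect_ind (noncut x0i xi x0w xw)) => // a b [aj0 aw] /and3P[ab _ bw].
  by split=> //; have [] := vD' _ _ _ (next _ _ aj0 aw ab).
have sub : (D i).2 \subset (D' j0).2.
  apply/subsetP=> -[x y] xy; have [xi yi] := vD _ _ _ xy.
  have /is_subgraphP/(_ _ _ xy)[axy _ _ yx] := sg i.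
  have [xw|xw] := eqVneq x (w i); last by apply: next => //; apply: all_in.
  have yw : y != w i by apply: contraTneq axy => ->; rewrite xw (Hsimp.2).
  have /is_subgraphP := sg' j0; move=> /(_ y x)[] //.
  by apply: next => //; apply: all_in.
have ij0 : i = j0.
  apply/eqP; apply: contraT => /inc; case; apply: (iso_to_subgraph_sub (sg i) (si i) (si' j0) _ sub).
  exact: sub_iso_sub1 (si i) (sg' j0) sub.
by rewrite -ij0 in sub; apply/esym; apply: sub_iso_eq (si i) (si' i) (sg i) (sg' i) sub.
Qed.

Lemma decomp_path_unique : D' = D.
Proof.
apply/ffunP; suff h n (i : 'I_k) : i < n -> D' i = D i by move=> i; apply: (h i.+1).
elim: n i => // n IHn i; rewrite ltnS leq_eqVlt => /orP[/eqP in_|/IHn//].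
by apply: piece_step => j ji; apply: IHn; rewrite -in_.
Qed.
End Unique.
End Decomposition.

(** * The path gluing *)

Section PathGluing.
Variables (k0 : nat).
Notation k := k0.+1.
Variables (Gs : 'I_k -> graph) (z v : forall i, vert (Gs i)).
Hypothesis simp : forall i, simple (Gs i).
Hypothesis conn : forall i, gconnected (Gs i).
Hypothesis gt1 : forall i, 1 < #|vert (Gs i)|.
Hypothesis inc : forall i j, i != j -> ~ iso_to_subgraph (Gs i) (Gs j).
Hypothesis zv : forall i, z i != v i.
Hypothesis noncut : forall i x, x != v i -> connect (avoid (v i)) (z i) x.

Let T := {i : 'I_k & vert (Gs i)}.
Definition tag_of (i : 'I_k) (x : vert (Gs i)) : T := Tagged (fun i => vert (Gs i)) x.
Definition pg_prev (i : 'I_k) : 'I_k := inord i.-1.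

(* [z i] is identified with [v (i-1)], so the pieces form a path *)
Definition glue (i : 'I_k) (x : vert (Gs i)) : T :=
  if (0 < i) && (x == z i) then tag_of (v (pg_prev i)) else tag_of x.

(** The vertices of the gluing are representatives in the disjoint sum, which avoids a quotient. One
    redirection by [glue] reaches the representative because [v j] differs from [z j], so its target
    is never redirected itself. *)
Definition glued : pred T := [pred t | [exists i, exists x : vert (Gs i), glue x == t]].

Lemma glue_glued i (x : vert (Gs i)) : glued (glue x).
Proof. by apply/existsP; exists i; apply/existsP; exists x. Qed.

Definition pg_vert := {t : T | glued t}.
Definition pg_inj i (x : vert (Gs i)) : pg_vert := exist _ (glue x) (glue_glued x).

Definition pg : graph := @Graph pg_vert (fun a b =>
  [exists i, exists x : vert (Gs i), exists y, [&& pg_inj x == a, pg_inj y == b & adj x y]]).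

Lemma pg_prev_val (i : 'I_k) : pg_prev i = i.-1 :> nat.
Proof. by rewrite inordK // (leq_ltn_trans (leq_pred _) (ltn_ord i)). Qed.

Lemma tag_of_inj i : injective (@tag_of i).
Proof. by move=> x y /eqP; rewrite /tag_of eq_Tagged => /eqP. Qed.

Lemma glue_tag i (x : vert (Gs i)) :
  (glue x = tag_of x /\ ~~ ((0 < i) && (x == z i))) \/
  [/\ glue x = tag_of (v (pg_prev i)), 0 < i & x = z i].
Proof.
rewrite /glue; case: ifP => [/andP[? /eqP]|]; first by right.
by left.
Qed.

Lemma tag_neq (i j : 'I_k) (x : vert (Gs i)) (y : vert (Gs j)) : tag_of x = tag_of y -> i = j.
Proof. by move/(congr1 (fun t : T => tag t)). Qed.

Lemma pg_inj_inj i : injective (@pg_inj i).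
Proof.
move=> x y /(congr1 val) /=; case: (glue_tag x) => [[-> nx]|[-> i0 ->]];
  case: (glue_tag y) => [[-> ny]|[-> j0 ->]] //.
- by apply: tag_of_inj.
- by move/tag_neq => /(congr1 val) /=; rewrite pg_prev_val; lia.
- by move/tag_neq => /(congr1 val) /=; rewrite pg_prev_val; lia.
Qed.

Lemma pg_inj_meet (i j : 'I_k) (x : vert (Gs i)) (y : vert (Gs j)) :
  i < j -> pg_inj x = pg_inj y -> [/\ i.+1 = j, x = v i & y = z j].
Proof.
move=> ij /(congr1 val) /=; case: (glue_tag x) => [[-> nx]|[-> i0 ->]];
  case: (glue_tag y) => [[-> ny]|[-> j0 ->]] //.
- by move/tag_neq => e; rewrite e ltnn in ij.
- move=> e; have ei := tag_neq e; subst i.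
  by rewrite (tag_of_inj e); split=> //; rewrite pg_prev_val; lia.
- by move/tag_neq => /(congr1 val) /=; rewrite pg_prev_val; lia.
- by move/tag_neq => /(congr1 val) /=; rewrite !pg_prev_val; lia.
Qed.

Lemma pg_inj_glue (i j : 'I_k) : i.+1 = j -> pg_inj (v i) = pg_inj (z j).
Proof.
move=> ij; apply: val_inj => /=.
have -> : i = pg_prev j by apply: val_inj; rewrite /= pg_prev_val -ij.
rewrite /glue eqxx -ij /= eq_sym (negPf (zv _)) andbF //.
Qed.

Lemma pg_inj_surj (t : pg_vert) : exists i (x : vert (Gs i)), t = pg_inj x.
Proof.
case: t => t gt; have /existsP[i /existsP[x /eqP e]] := gt.
by exists i, x; apply: val_inj; rewrite /= e.
Qed.

(** Only the vertices [z i] with [0 < i] can be lost, at most [k0] of them. This is the count on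
    which [decomp_meet] rests. *)
Lemma pg_card : \sum_i #|vert (Gs i)| < #|vert pg| + k.
Proof.
have <- : #|{: T}| = \sum_i #|vert (Gs i)|.
  by rewrite card_tagged sumnE big_map big_enum.
have -> : #|vert pg| = #|glued| by rewrite card_sig; apply: eq_card.
rewrite -(cardC glued) addnS ltnS leq_add2l.
have sub : [predC glued] \subset [set tag_of (z (lift ord0 i)) | i : 'I_k0].
  apply/subsetP => -[i x]; rewrite !inE => /existsPn/(_ i)/existsPn/(_ x).
  case: (glue_tag x) => [[-> _]|[_ i0 ->] _]; first by rewrite eqxx.
  have ik : i.-1 < k0 by have := ltn_ord i; lia.
  have -> : i = lift ord0 (Ordinal ik) by apply: val_inj; rewrite /= /bump /=; lia.
  by apply/imsetP; exists (Ordinal ik).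
by apply: leq_trans (subset_leq_card sub) _; rewrite (leq_trans (leq_imset_card _ _)) // card_ord.
Qed.

Definition pg_piece : {ffun 'I_k -> subg_t pg} :=
  [ffun i => (@pg_inj i @: setT : {set vert pg},
              [set (pg_inj e.1, pg_inj e.2) | e in edge_set (Gs i)] : {set vert pg * vert pg})].

Lemma pg_piece_edge i a b : (a, b) \in (pg_piece i).2 ->
  exists x y, [/\ a = pg_inj x, b = pg_inj y & @adj (Gs i) x y].
Proof. by rewrite ffunE => /imsetP[[x y]]; rewrite inE /= => xy [-> ->]; exists x, y. Qed.

Lemma pg_piece_mem i (x y : vert (Gs i)) : adj x y -> (pg_inj x, pg_inj y) \in (pg_piece i).2.
Proof. by move=> xy; rewrite ffunE; apply/imsetP; exists (x, y); rewrite ?inE. Qed.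

Lemma pg_adjP (a b : pg_vert) : reflect (exists i, (a, b) \in (pg_piece i).2) (@adj pg a b).
Proof.
apply: (iffP existsP) => [[i /existsP[x /existsP[y /and3P[/eqP<- /eqP<- xy]]]]|[i]].
  by exists i; apply: pg_piece_mem.
move=> /pg_piece_edge[x [y [-> -> xy]]]; exists i.
by apply/existsP; exists x; apply/existsP; exists y; rewrite !eqxx.
Qed.

Lemma pg_piece_vert i (x : vert (Gs i)) : pg_inj x \in (pg_piece i).1.
Proof. by rewrite ffunE imset_f. Qed.

Lemma pg_piece_vertP i a : a \in (pg_piece i).1 -> exists x : vert (Gs i), a = pg_inj x.
Proof. by rewrite ffunE => /imsetP[x _ ->]; exists x. Qed.

Lemma pg_simple : simple pg.
Proof.
split=> [a b|a].
  by apply/pg_adjP/pg_adjP => -[i /pg_piece_edge[x [y [-> -> xy]]]]; exists i;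
     apply: pg_piece_mem; rewrite (simp i).1.
apply/pg_adjP => -[i /pg_piece_edge[x [y [-> /pg_inj_inj <-]]]].
by rewrite (simp i).2.
Qed.

Lemma pg_decomp : decomp Gs pg_piece.
Proof.
split=> [i||].
- apply/andP; split.
    apply/is_subgraphP => a b ab; have [x [y [-> -> xy]]] := pg_piece_edge ab.
    split; [|exact: pg_piece_vert|exact: pg_piece_vert|].
      by apply/pg_adjP; exists i; apply: pg_piece_mem.
    by apply: pg_piece_mem; rewrite (simp i).1.
  apply/sub_isoP; exists (@pg_inj i); split; first exact: pg_inj_inj.
    by rewrite ffunE.
  move=> x y; apply/idP/idP => [|/pg_piece_edge[a [b [/pg_inj_inj-> /pg_inj_inj->]]]//].
  exact: pg_piece_mem.
- apply/setP=> t; rewrite inE; apply/bigcupP; have [i [x ->]] := pg_inj_surj t.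
  by exists i => //; apply: pg_piece_vert.
- apply/setP=> -[a b]; rewrite inE /=; apply/bigcupP/pg_adjP => [[i _]|[i]]; by exists i.
Qed.

Lemma pg_connected : gconnected pg.
Proof.
have symm : connect_sym (@adj pg).
  by apply: sym_connect_sym; case: pg_simple.
have loc i (x y : vert (Gs i)) : connect (@adj pg) (pg_inj x) (pg_inj y).
  pattern y; apply: (connect_ind ((conn i).2 x y)) => [|a b h ab]; first exact: connect0.
  apply: (connect_trans h (connect1 _)).
  by apply/pg_adjP; exists i; apply: pg_piece_mem.
have root (i : 'I_k) (x : vert (Gs i)) : connect (@adj pg) (pg_inj (z ord0)) (pg_inj x).
  have [n in_] : exists n : nat, i = n :> nat by exists i.
  elim: n i x in_ => [|n IHn] i x in_.
    have i0 : i = ord0 by apply: val_inj.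
    by subst i; apply: loc.
  have nk : n < k by have := ltn_ord i; lia.
  apply: (connect_trans (IHn (Ordinal nk) (v (Ordinal nk)) _)) => //.
  by rewrite (@pg_inj_glue (Ordinal nk) i).
split; first by apply/card_gt0P; exists (pg_inj (z ord0)).
move=> a b; have [i [x ->]] := pg_inj_surj a; have [j [y ->]] := pg_inj_surj b.
by apply: (connect_trans (y := pg_inj (z ord0))); [rewrite symm|]; apply: root.
Qed.

Lemma pg_unique D' : decomp Gs D' -> D' = pg_piece.
Proof.
move=> dD'; apply: (decomp_path_unique pg_connected conn gt1 (w := fun i => pg_inj (v i))
  pg_simple inc pg_card pg_decomp dD') => [i j a ij|i a b].
  move=> /pg_piece_vertP[x ->] /pg_piece_vertP[y /(pg_inj_meet ij)[_ -> _]] //.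
move=> /pg_piece_vertP[x ->] /pg_piece_vertP[y ->].
rewrite !(inj_eq (@pg_inj_inj i)) => xv yv.
have nsym : connect_sym (avoid (v i)).
  apply: sym_connect_sym => c d; rewrite /avoid (simp i).1; congr (_ && _); exact: andbC.
have xy : connect (avoid (v i)) x y.
  by apply: (connect_trans (y := z i)); [rewrite nsym|]; apply: noncut.
pattern y; apply: (connect_ind xy) => [|c d h /and3P[cd cv dv]]; first exact: connect0.
apply: (connect_trans h (connect1 _)).
by rewrite !(inj_eq (@pg_inj_inj i)) cv dv; rewrite (pg_piece_mem cd).
Qed.

Lemma pg_meet i j : ((pg_piece i).1 :&: (pg_piece j).1 != set0) = (i <= j.+1) && (j <= i.+1).
Proof.
wlog ij : i j / i <= j.
  move=> h; have [/h//|/ltnW/h] := leqP i j.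
  by rewrite setIC andbC.
rewrite (leq_trans ij) //=; apply/set0Pn/idP => [[a]|ji].
  rewrite inE => /andP[/pg_piece_vertP[x ->] /pg_piece_vertP[y xy]].
  move: ij; rewrite leq_eqVlt => /orP[/eqP-> //|ij].
  by have [<- _ _] := pg_inj_meet ij xy.
move: ij; rewrite leq_eqVlt => /orP[/eqP/val_inj <-|ij].
  by exists (pg_inj (z i)); apply/setIP; split; apply: pg_piece_vert.
have ij' : i.+1 = j by apply/eqP; rewrite eqn_leq ij.
exists (pg_inj (v i)); apply/setIP; split; first exact: pg_piece_vert.
by rewrite (pg_inj_glue ij'); apply: pg_piece_vert.
Qed.

End PathGluing.

(** All that the counting half uses of the gluing: uniqueness identifies the relevant copies, the
    intersection pattern turns disjointness of pieces into proper colourings, and edge-disjointness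
    yields independence. *)
Definition path_decomp k (Gs : 'I_k -> graph) (H : graph) (D : {ffun 'I_k -> subg_t H}) : Prop :=
  [/\ decomp Gs D, forall D', decomp Gs D' -> D' = D,
      forall i j, ((D i).1 :&: (D j).1 != set0) = (i <= j.+1) && (j <= i.+1) &
      forall i j x y, (x, y) \in (D i).2 -> (x, y) \in (D j).2 -> i = j].

Lemma path_gluing (k : nat) (Gs : 'I_k -> graph) : 2 <= k ->
  (forall i, simple (Gs i)) -> (forall i, gconnected (Gs i)) ->
  (forall i j, i != j -> ~ iso_to_subgraph (Gs i) (Gs j)) ->
  exists (H : graph) (D : {ffun 'I_k -> subg_t H}),
    [/\ simple H, gconnected H & path_decomp Gs D].
Proof.
move=> k2 simp conn inc; have gt1 := incomparable_card_gt1 k2 simp conn inc.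
case: k Gs k2 simp conn inc gt1 => // k0 Gs k2 simp conn inc gt1.
have /fin_all_exists[zv zvP] := fun i => noncut_vertex (conn i) (gt1 i).
pose z i := (zv i).1; pose v i := (zv i).2.
have zv_neq i : z i != v i := (zvP i).1.
have nc i x : x != v i -> connect (avoid (v i)) (z i) x by case: (zvP i) => _; apply.
exists (pg z v), (pg_piece z v).
have s := pg_simple z v simp; have c := pg_connected simp conn zv_neq.
have d := pg_decomp z v simp.
split=> //; split=> //.
- exact: pg_unique.
- exact: pg_meet.
- by move=> i j x y; have := decomp_edge_disjoint c gt1 s (pg_card z v) d; exact.
Qed.

Lemma path_rel_tree (k : nat) (e : rel 'I_k) : 0 < k ->
  (forall i j, e i j = (i != j) && ((i <= j.+1) && (j <= i.+1))) -> is_tree e.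
Proof.
move=> k0 eE; split; first by rewrite card_ord.
have esym : symmetric e by move=> i j; rewrite !eE eq_sym [X in _ && X]andbC.
split.
  move=> x y; wlog xy : x y / x <= y.
    by move=> h; have [/h//|/ltnW/h] := leqP x y; rewrite (sym_connect_sym esym).
  have [n yn] : exists n, y = x + n :> nat by exists (y - x); rewrite subnKC.
  elim: n y yn xy => [|n IHn] y yn xy.
    by have -> : x = y; [apply: val_inj; rewrite /= yn addn0|exact: connect0].
  have nk : x + n < k by have := ltn_ord y; lia.
  apply: (connect_trans (IHn (Ordinal nk) erefl (leq_addr _ _)) (connect1 _)).
  by rewrite eE -val_eqE /= yn; lia.
(* a neighbour of the largest vertex of a cycle is its predecessor in the path *)
case=> s /and3P[us s2 cs].
have [m ms maxm] : exists2 m, m \in s & forall j, j \in s -> j <= m.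
  case: s s2 {us cs} => // a s _.
  case: (@arg_maxnP _ a [in a :: s] (@nat_of_ord k)) => [|m ms mx]; first exact: mem_head.
  by exists m.
have [i s' rs] := rot_to ms.
have : cycle e (rot i s) by rewrite rot_cycle.
have : uniq (rot i s) by rewrite rot_uniq.
have : 2 < size (rot i s) by rewrite size_rot.
have mx j : j \in rot i s -> j <= m by rewrite mem_rot; apply: maxm.
rewrite rs in mx *; case: s' {rs} mx => // a s'.
case/lastP: s' => // s' b mx _ /= /andP[_ /andP[anb _]].
rewrite rcons_path last_rcons !eE => /and3P[/andP[ma maE] _ /andP[bm bmE]].
have am : a <= m by apply: mx; rewrite !inE eqxx orbT.
have bm' : b <= m by apply: mx; rewrite !inE mem_rcons mem_head !orbT.
have ab : a = b.
  apply: val_inj => /=; move: ma bm; rewrite -!val_eqE /=; lia.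
by rewrite ab mem_rcons mem_head in anb.
Qed.

Lemma path_decomp_tree_like (k : nat) (Gs : 'I_k -> graph) (H : graph)
  (D : {ffun 'I_k -> subg_t H}) : 0 < k ->
  simple H -> gconnected H -> path_decomp Gs D -> tree_like Gs H.
Proof.
move=> k0 sH cH [dD uD mD _]; split; first by split=> //; split=> //; exists D.
by exists D; split=> //; apply: path_rel_tree => // i j; rewrite /struct_rel mD.
Qed.

(** If [H] were isomorphic to [Gs i], the piece [D i] would have as many edges as [H] and leave none
    for the other pieces. *)
Lemma path_decomp_not_iso (k : nat) (Gs : 'I_k -> graph) (H : graph)
  (D : {ffun 'I_k -> subg_t H}) : 1 < k ->
  (forall i, gconnected (Gs i)) -> (forall i, 1 < #|vert (Gs i)|) ->
  path_decomp Gs D -> forall i, ~ giso H (Gs i).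
Proof.
move=> k1 conn gt1 [[sD _ eD] _ _ dis] i [f [fb fa]].
have le : #|edge_set H| <= #|(D i).2|.
  have /andP[sg si] := sD i; rewrite (sub_iso_card_edges sg si).
  rewrite -(card_imset _ (f := fun e => (f e.1, f e.2))).
    apply/subset_leq_card/subsetP => e /imsetP[[x y]]; rewrite inE /= => xy ->.
    by rewrite inE /= -fa.
  by move=> [a b] [c d] /= [/(bij_inj fb)-> /(bij_inj fb)->].
have [j ij] : exists j, i != j.
  have /card_gt1P[a [b [_ _ ab]]] : 1 < #|'I_k| by rewrite card_ord.
  by have [ia|?] := eqVneq i a; [exists b; rewrite ia|exists a].
have /andP[sg si] := sD j.
have [x xj] : exists x, x \in (D j).1.
  by apply/card_gt0P; rewrite (sub_iso_card_vert si); apply: ltnW.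
have [y xy] := sub_iso_has_edge (conn j) (gt1 j) si xj.
have sub l : (D l).2 \subset edge_set H by rewrite -eD; apply: (bigcup_sup l).
have eq : (D i).2 = edge_set H by apply/eqP; rewrite eqEcard sub.
have xyi : (x, y) \in (D i).2 by rewrite eq; apply: (subsetP (sub j)).
by case/eqP: ij; apply: dis xyi xy.
Qed.

(** * Copies of the disjoint union inside disjoint copies of the gluing *)

(** A proper colouring of the path on ['I_k], where the colour [f i] names the copy of the gluing
    that hosts piece [i]. *)
Definition proper_col (r k : nat) (f : 'I_k -> 'I_r) : bool :=
  [forall i : 'I_k, forall j : 'I_k, (i.+1 == j :> nat) ==> (f i != f j)].

Lemma card_oriented (T : finType) (rk : T -> nat) (S : {set T * T}) : injective rk ->
  (forall x y, (x, y) \in S -> x != y /\ (y, x) \in S) ->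
  #|S| = (#|[set e in S | rk e.1 < rk e.2]|).*2.
Proof.
move=> rki sym; set S1 := [set e in S | _].
pose S2 := [set e in S | rk e.2 < rk e.1].
have -> : S = S1 :|: S2.
  apply/setP=> -[x y]; rewrite !inE /= -andb_orr; case: (boolP (_ \in S)) => //= /sym[xy _].
  by rewrite -neq_ltn (inj_eq rki) xy.
have -> : #|S1 :|: S2| = #|S1| + #|S2|.
  rewrite cardsU [X in _ - X](_ : _ = 0) ?subn0 //; apply/eqP; rewrite cards_eq0.
  by apply/eqP/setP=> -[x y]; rewrite !inE /=; case: ltngtP; rewrite ?andbF.
rewrite -addnn; congr (_ + _); rewrite -(card_imset S1 (f := fun e => (e.2, e.1))).
  apply: eq_card => -[x y]; rewrite !inE /=; apply/andP/imsetP => [[xy lt]|[[a b]]].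
    by exists (y, x); rewrite ?inE /= ?lt ?(sym _ _ xy).2.
  by rewrite inE /= => /andP[ab lt] [-> ->]; rewrite lt (sym _ _ ab).2.
by move=> [a b] [c e] /= [-> ->].
Qed.

(** Potential copies live in the complete graph. One is present in a random graph exactly when its
    [up_edges] are, which makes the count a polynomial in the edge indicators. *)
Definition Kn (n : nat) : graph := @Graph 'I_n (fun x y => x != y).

Definition is_copy (A : graph) (n : nat) (s : subg_t (Kn n)) : bool := is_subgraph s && sub_iso A s.
Definition up_edges (n : nat) (s : subg_t (Kn n)) : {set 'I_n * 'I_n} := s.2 :&: upper n.

Lemma card_up (A : graph) n (s : subg_t (Kn n)) : is_copy A s -> #|edge_set A| = #|up_edges s|.*2.
Proof.
case/andP=> sg si; rewrite -(sub_iso_card_edges sg si).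
rewrite (@card_oriented _ (@nat_of_ord n) s.2 (@ord_inj n)); last first.
  by move=> x y /(is_subgraphP _ sg)[].
by congr (_.*2); apply: eq_card => e; rewrite !inE.
Qed.

Section Copies.
Variables (k : nat) (Gs : 'I_k -> graph) (H : graph) (D : {ffun 'I_k -> subg_t H}).
Hypothesis simp : forall i, simple (Gs i).
Hypothesis conn : forall i, gconnected (Gs i).
Hypothesis gt1 : forall i, 1 < #|vert (Gs i)|.
Hypotheses (sH : simple H) (cH : gconnected H) (H1 : 1 < #|vert H|).
Hypothesis pD : path_decomp Gs D.
Variables (n r : nat) (psi : 'I_r -> vert H -> 'I_n).
Hypothesis psi_inj : forall j a j' a', psi j a = psi j' a' -> j = j' /\ a = a'.
Hypothesis psi_mono : forall j a b, (psi j a < psi j b) = (enum_rank a < enum_rank b).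

Notation A := (disj_union Gs).
Let dD : decomp Gs D. Proof. by case: pD. Qed.
Let sg i : is_subgraph (D i). Proof. by case: dD => /(_ i)/andP[]. Qed.
Let si i : sub_iso (Gs i) (D i). Proof. by case: dD => /(_ i)/andP[]. Qed.

(** One orientation per edge, chosen so that the embeddings [psi j], monotone in [enum_rank], carry
    it into [upper n]. *)
Definition orient (S : {set vert H * vert H}) : {set vert H * vert H} :=
  [set e in S | enum_rank e.1 < enum_rank e.2].
Definition edge j (e : vert H * vert H) : 'I_n * 'I_n := (psi j e.1, psi j e.2).
Definition cls (e : vert H * vert H) : {set 'I_n * 'I_n} := [set edge j e | j : 'I_r].
Definition block (i : 'I_k) (j : 'I_r) : {set 'I_n * 'I_n} := [set edge j e | e in orient (D i).2].
Definition spread (f : 'I_k -> 'I_r) : subg_t (Kn n) :=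
  (\bigcup_i [set psi (f i) a | a in (D i).1], \bigcup_i [set edge (f i) e | e in (D i).2]).

Lemma edge_inj j e j' e' : edge j e = edge j' e' -> j = j' /\ e = e'.
Proof. by case: e e' => [a b] [a' b'] [/psi_inj[-> ->] /psi_inj[_ ->]]. Qed.

Lemma edge_upper j e : (edge j e \in upper n) = (enum_rank e.1 < enum_rank e.2).
Proof. by rewrite inE psi_mono. Qed.

Lemma dis_edges i j e : e \in (D i).2 -> e \in (D j).2 -> i = j.
Proof. by case: e => a b; case: pD => _ _ _; apply. Qed.

Lemma edgesP e : reflect (exists i, e \in (D i).2) (e \in edge_set H).
Proof.
case: dD => _ _ <-; apply: (iffP bigcupP) => [[i _]|[i]]; by exists i.
Qed.

Lemma spread_edgeP f (x y : 'I_n) : reflect (exists i a b,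
  [/\ (a, b) \in (D i).2, x = psi (f i) a & y = psi (f i) b]) ((x, y) \in (spread f).2).
Proof.
apply: (iffP bigcupP) => [[i _ /imsetP[[a b] ab [-> ->]]]|[i [a [b [ab -> ->]]]]].
  by exists i, a, b.
by exists i => //; apply/imsetP; exists (a, b).
Qed.

Lemma up_spread f : up_edges (spread f) = \bigcup_i block i (f i).
Proof.
apply/setP=> e; rewrite inE; apply/andP/bigcupP => [[/bigcupP[i _ /imsetP[e' e'D ->]]]|].
  by rewrite edge_upper => lt; exists i => //; apply: imset_f; rewrite inE e'D.
case=> i _ /imsetP[e']; rewrite inE => /andP[e'D lt] ->; rewrite edge_upper lt; split=> //.
by apply/bigcupP; exists i => //; apply: imset_f.
Qed.

Lemma spread_copy (f : 'I_k -> 'I_r) : proper_col f -> is_copy A (spread f).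
Proof.
move=> pf; apply/andP; split.
  apply/is_subgraphP => x y /spread_edgeP[i [a [b [ab -> ->]]]].
  have [adj_ab aD bD ba] := is_subgraphP _ (sg i) _ _ ab.
  split; first by apply: contraTneq adj_ab => /psi_inj[_ ->]; rewrite (sH.2 b).
  - by apply/bigcupP; exists i => //; apply: imset_f.
  - by apply/bigcupP; exists i => //; apply: imset_f.
  - by apply/spread_edgeP; exists i, b, a.
have /(@fin_all_exists _ _ (fun i (g : vert (Gs i) -> vert H) => [/\ injective g, g @: setT = (D i).1 &
    forall x y, adj x y = ((g x, g y) \in (D i).2)]))[g gP] := fun i => sub_isoP _ _ (si i).
have gD i x : g i x \in (D i).1 by have [_ <- _] := gP i; rewrite imset_f.
pose F (v : vert A) : 'I_n := psi (f (tag v)) (g _ (tagged v)).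
(* A common value places two pieces with a common vertex in the same copy of [H]. They are then
   equal or consecutive, and properness excludes the latter. *)
have Fi : injective F.
  move=> [i x] [i' x'] /psi_inj /= [fii gxx].
  have ii : i = i'.
    apply/eqP; apply: contraT => ii.
    have : (D i).1 :&: (D i').1 != set0.
      by apply/set0Pn; exists (g i x); rewrite inE gD gxx gD.
    have [_ _ -> _] := pD; move=> /andP[le1 le2]; move/forallP: pf => pf.
    have [lt|lt|e] := ltngtP i i'; last by rewrite (val_inj e) eqxx in ii.
      have /forallP/(_ i')/implyP := pf i; rewrite fii eqxx; apply.
      by rewrite eqn_leq lt.
    have /forallP/(_ i)/implyP := pf i'; rewrite fii eqxx; apply.
    by rewrite eqn_leq lt.
  by subst i'; have [gi _ _] := gP i; rewrite (gi _ _ gxx).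
apply/sub_isoP; exists F; split=> //.
  apply/setP=> x; apply/imsetP/bigcupP => [[[i a] _ ->]|[i _ /imsetP[a]]].
    by exists i => //; apply/imsetP; exists (g i a).
  have [_ <- _] := gP i; move=> /imsetP[b _ ->] ->.
  by exists (Tagged (fun i => vert (Gs i)) b).
move=> [i x] [i' x']; apply/idP/spread_edgeP => [/andP[/eqP /= ii]|[m [a [b [ab ea eb]]]]].
  subst i'; rewrite tagged_asE /= => xx; exists i, (g i x), (g i x'); split=> //.
  by have [_ _ <-] := gP i.
have [_ aD bD _] := is_subgraphP _ (sg m) _ _ ab.
have [gi gs ga] := gP m.
move: aD bD ab ea eb; rewrite -gs => /imsetP[y _ ->] /imsetP[y' _ ->] ab ea eb.
have /Fi e1 : F (Tagged (fun i => vert (Gs i)) x) = F (Tagged (fun i => vert (Gs i)) y) by [].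
have /Fi e2 : F (Tagged (fun i => vert (Gs i)) x') = F (Tagged (fun i => vert (Gs i)) y') by [].
rewrite -[existT _ i x]/(Tagged (fun i => vert (Gs i)) x) e1.
rewrite -[existT _ i' x']/(Tagged (fun i => vert (Gs i)) x') e2 /=.
by rewrite eqxx tagged_asE ga.
Qed.

Lemma oriented_edge i : exists e, e \in orient (D i).2.
Proof.
have /card_gt1P[x _] := gt1 i; have [f [fi fs fa]] := sub_isoP _ _ (si i).
have fx : f x \in (D i).1 by rewrite -fs imset_f.
have [y xy] := sub_iso_has_edge (conn i) (gt1 i) (si i) fx.
have [axy _ _ yx] := is_subgraphP _ (sg i) _ _ xy.
have ne : f x != y by apply: contraTneq axy => ->; rewrite (sH.2 y).
have : enum_rank (f x) != enum_rank y :> nat.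
  by rewrite (inj_eq val_inj) (inj_eq enum_rank_inj).
rewrite neq_ltn => /orP[lt|lt]; first by exists (f x, y); rewrite inE xy.
by exists (y, f x); rewrite inE yx.
Qed.

Lemma block_neq0 i j : block i j != set0.
Proof.
have [e eD] := oriented_edge i; apply/set0Pn; exists (edge j e); exact: imset_f.
Qed.

Lemma block_disjoint i j i' j' : (i, j) != (i', j') -> [disjoint block i j & block i' j'].
Proof.
move=> ne; apply: contraR ne; rewrite -setI_eq0 => /set0Pn[x].
rewrite inE => /andP[/imsetP[e eD ->] /imsetP[e' eD' /edge_inj[-> ee]]].
move: eD eD'; rewrite -ee !inE => /andP[eD _] /andP[eD' _].
by rewrite (dis_edges eD eD').
Qed.

Lemma block_upper i j : block i j \subset upper n.
Proof.
by apply/subsetP => _ /imsetP[e eD ->]; rewrite edge_upper; move: eD; rewrite inE => /andP[].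
Qed.

Lemma block_card j : #|\bigcup_i block i j| <= #|orient (edge_set H)|.
Proof.
apply: leq_trans (leq_imset_card (edge j) _); apply/subset_leq_card/subsetP => x.
case/bigcupP=> i _ /imsetP[e]; rewrite inE => /andP[eD lt] ->; apply: imset_f.
by rewrite inE lt andbT; apply/edgesP; exists i.
Qed.

Lemma spread_inj (f f' : {ffun 'I_k -> 'I_r}) : spread f = spread f' -> f = f'.
Proof.
move=> e; apply/ffunP => i; have [c cD] := oriented_edge i.
have : edge (f i) c \in up_edges (spread f).
  by rewrite up_spread; apply/bigcupP; exists i => //; apply: imset_f.
rewrite e up_spread => /bigcupP[m _ /imsetP[c' c'D /edge_inj[-> cc]]].
move: cD c'D; rewrite -cc !inE => /andP[cD _] /andP[cD' _].
by rewrite (dis_edges cD cD').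
Qed.

Lemma spread_hits f e : e \in orient (edge_set H) -> up_edges (spread f) :&: cls e != set0.
Proof.
rewrite inE => /andP[/edgesP[i eD] lt]; apply/set0Pn; exists (edge (f i) e).
apply/setIP; split; last by apply/imsetP; exists (f i).
rewrite up_spread; apply/bigcupP; exists i => //.
by apply: imset_f; rewrite inE eD.
Qed.

Lemma cls_disjoint e e' : e != e' -> [disjoint cls e & cls e'].
Proof.
move=> ne; apply: contraR ne; rewrite -setI_eq0 => /set0Pn[x].
by rewrite inE => /andP[/imsetP[j _ ->] /imsetP[j' _ /edge_inj[_ ->]]].
Qed.

(** The pieces cover the edges of [H] without overlap. Hence a copy has as many edges as there are
    classes, and meeting every class forces exactly one edge in each. *)
Lemma card_edges : #|edge_set A| = #|edge_set H|.
Proof.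
have /(@fin_all_exists _ _ (fun i (g : vert (Gs i) -> vert H) => [/\ injective g, g @: setT = (D i).1 &
    forall x y, adj x y = ((g x, g y) \in (D i).2)]))[g gP] := fun i => sub_isoP _ _ (si i).
pose G (v : vert A) := g _ (tagged v).
pose GG (e : vert A * vert A) := (G e.1, G e.2).
have GGD i x i' x' : (existT _ i x, existT _ i' x') \in edge_set A -> i = i' /\ (g i x, g i' x') \in (D i).2.
  rewrite inE /= => /andP[/eqP /= ii]; subst i'; rewrite tagged_asE /=.
  by have [_ _ ->] := gP i.
have -> : edge_set H = [set GG e | e in edge_set A].
  apply/setP=> -[a b]; apply/edgesP/imsetP => [[i ab]|[[[i x] [i' x']] /GGD[ii xD] [-> ->]]].
    have [gi gs ga] := gP i.
    have [_ aD bD _] := is_subgraphP _ (sg i) _ _ ab.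
    move: aD bD ab; rewrite -gs => /imsetP[y _ ->] /imsetP[y' _ ->] ab.
    exists (Tagged (fun i => vert (Gs i)) y, Tagged (fun i => vert (Gs i)) y') => //.
    by rewrite inE /= eqxx tagged_asE /= ga.
  by exists i.
rewrite card_in_imset // => -[[i x] [i' x']] [[j y] [j' y']] /GGD[ii xD] /GGD[jj yD].
subst i' j'; case=> e1 e2; rewrite /G /= in e1 e2.
have ij : i = j by apply: dis_edges xD _; rewrite e1 e2.
by subst j; have [gi _ _] := gP i; rewrite (gi _ _ e1) (gi _ _ e2).
Qed.

Lemma card_up_copy (s : subg_t (Kn n)) : is_copy A s -> #|up_edges s| = #|orient (edge_set H)|.
Proof.
move/card_up; rewrite card_edges (@card_oriented _ (fun a => enum_rank a : nat)).
- by move/double_inj.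
- by move=> a b /val_inj/enum_rank_inj.
move=> a b; rewrite !inE /= => ab; rewrite -sH.1; split=> //.
by apply: contraTneq ab => ->; rewrite (sH.2 b).
Qed.

(* projecting the components of a copy to [H] gives a decomposition, hence the canonical one *)
Lemma copy_spread (s : subg_t (Kn n)) : is_copy A s ->
  (forall e, e \in orient (edge_set H) -> up_edges s :&: cls e != set0) ->
  up_edges s \subset \bigcup_(e in orient (edge_set H)) cls e ->
  exists2 f : {ffun 'I_k -> 'I_r}, proper_col f & s = spread f.
Proof.
case/andP=> ss /sub_isoP[F [Fi Fs Fa]] hit free.
have free' x y : (x, y) \in s.2 -> exists j a b, [/\ x = psi j a, y = psi j b & @adj H a b].
  move=> xy; have [xy_ne _ _ yx] := is_subgraphP _ ss _ _ xy.
  have get x' y' : (x', y') \in s.2 -> x' < y' -> exists j a b, [/\ x' = psi j a, y' = psi j b & @adj H a b].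
    move=> xy' lt; have /(subsetP free)/bigcupP[[a b]] : (x', y') \in up_edges s by rewrite !inE xy'.
    by rewrite !inE /= => /andP[ab _] /imsetP[j _ [-> ->]]; exists j, a, b.
  have : x != y :> nat by [].
  rewrite neq_ltn => /orP[|] lt; first exact: get.
  have [j [a [b [-> -> ab]]]] := get _ _ yx lt; exists j, b, a; split=> //.
  by rewrite sH.1.
pose tg i (x : vert (Gs i)) : vert A := Tagged (fun i => vert (Gs i)) x.
have tgadj i x y : @adj A (tg i x) (tg i y) = adj x y by rewrite /= eqxx tagged_asE.
have tg_inj i : injective (tg i) by move=> x y /eqP; rewrite eq_Tagged => /eqP.
(* Every edge of [s] lies within one copy of [H], so a connected component of [s] never changes
   copies. *)
have one i : exists jg : 'I_r * {ffun vert (Gs i) -> vert H}, forall x, F (tg i x) = psi jg.1 (jg.2 x).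
  have /card_gt1P[x0 _] := gt1 i; have [y0 xy0] := connected_has_edge (conn i) (gt1 i) x0.
  have [j [a0 [_ [e0 _ _]]]] : exists j a b, [/\ F (tg i x0) = psi j a, F (tg i y0) = psi j b & @adj H a b].
    by apply: free'; rewrite -Fa tgadj.
  have ex x : exists a, F (tg i x) = psi j a.
    pattern x; apply: (connect_ind ((conn i).2 x0 x)) => [|b c [a ea] bc]; first by exists a0.
    have [j' [a' [b' [e1 e2 _]]]] :
        exists j a1 b1, [/\ F (tg i b) = psi j a1, F (tg i c) = psi j b1 & @adj H a1 b1].
      by apply: free'; rewrite -Fa tgadj.
    by move: e1; rewrite ea => /psi_inj[-> _]; exists b'.
  have [g gE] := fin_all_exists (P := fun x a => F (tg i x) = psi j a) ex.
  by exists (j, finfun g) => x; rewrite ffunE.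
have [jg jgE] := fin_all_exists (P := fun i (jg : 'I_r * {ffun vert (Gs i) -> vert H}) =>
   forall x, F (tg i x) = psi jg.1 (jg.2 x)) one.
pose f : {ffun 'I_k -> 'I_r} := [ffun i => (jg i).1]; pose g i := (jg i).2.
have FE i x : F (tg i x) = psi (f i) (g i x) by rewrite ffunE jgE.
have gi i : injective (g i).
  by move=> x y e; apply/(@tg_inj i)/Fi; rewrite !FE e.
have gadj i x y : adj x y -> @adj H (g i x) (g i y).
  rewrite -tgadj Fa !FE => /free'[j [a [b [/psi_inj[_ ->] /psi_inj[_ ->]]]]] //.
pose D' : {ffun 'I_k -> subg_t H} :=
  [ffun i => (g i @: setT, [set (g i e.1, g i e.2) | e in edge_set (Gs i)])].
have D'P i a b : reflect (exists x y, [/\ a = g i x, b = g i y & adj x y]) ((a, b) \in (D' i).2).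
  rewrite ffunE; apply: (iffP imsetP) => [[[x y]]|[x [y [-> -> xy]]]].
    by rewrite inE /= => xy [-> ->]; exists x, y.
  by exists (x, y); rewrite ?inE.
have gD' i x : g i x \in (D' i).1 by rewrite ffunE imset_f.
have Aadj u v : @adj A u v -> exists i x y, [/\ u = tg i x, v = tg i y & adj x y].
  case: u v => [i x] [i' x'] /andP[/eqP /= ii]; subst i'; rewrite tagged_asE /= => xy.
  by exists i, x, x'.
have sE x y : (x, y) \in s.2 -> exists i a b, [/\ x = F (tg i a), y = F (tg i b) & adj a b].
  move=> xy; have [_ xs ys _] := is_subgraphP _ ss _ _ xy.
  move: xs ys xy; rewrite -Fs => /imsetP[u _ ->] /imsetP[v _ ->]; rewrite -Fa.
  by move=> /Aadj[i [a [b [-> -> ab]]]]; exists i, a, b.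
(* Since [s] meets every class, each oriented edge of [H] is the projection of an edge of [s];
   symmetry gives the reversed ones. *)
have covE a b : (a, b) \in edge_set H -> exists i, (a, b) \in (D' i).2.
  have go a' b' : (a', b') \in orient (edge_set H) -> exists i, (a', b') \in (D' i).2.
    move=> /hit/set0Pn[t]; rewrite inE => /andP[/setIP[ts _] /imsetP[j _ te]].
    rewrite te /edge /= in ts; have [i [x [y [ex ey xy]]]] := sE _ _ ts.
    exists i; apply/D'P; exists x, y; split=> //.
      by move: ex; rewrite FE => /psi_inj[_ ->].
    by move: ey; rewrite FE => /psi_inj[_ ->].
  rewrite inE /= => ab; have ne : enum_rank a != enum_rank b :> nat.
    rewrite (inj_eq val_inj) (inj_eq enum_rank_inj).
    by apply: contraTneq ab => ->; rewrite (sH.2 b).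
  move: ne; rewrite neq_ltn => /orP[lt|lt]; first by apply: go; rewrite !inE ab.
  have [|i] := go b a; first by rewrite !inE /= sH.1 ab.
  move=> /D'P[x [y [eb ea xy]]]; exists i; apply/D'P; exists y, x; split=> //.
  by rewrite (simp i).1.
have dD' : decomp Gs D'.
  split=> [i||].
  - apply/andP; split.
      apply/is_subgraphP => _ _ /D'P[x [y [-> -> xy]]].
      split=> //; first exact: gadj.
      by apply/D'P; exists y, x; rewrite (simp i).1.
    apply/sub_isoP; exists (g i); split; [exact: gi|by rewrite [D' i]ffunE|].
    move=> x y; apply/idP/D'P => [xy|[x' [y' [/gi-> /gi-> //]]]].
    by exists x, y.
  - apply/setP=> a; rewrite inE; apply/bigcupP.
    have [b ab] := connected_has_edge cH H1 a.
    have [|i /D'P[x [y [-> _ _]]]] := covE a b; first by rewrite inE.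
    by exists i.
  - apply/setP=> -[a b]; apply/bigcupP/idP => [[i _ /D'P[x [y [-> -> xy]]]]|/covE[i]].
      by rewrite inE /=; apply: gadj.
    by exists i.
have eD : D' = D by have [_ uD _ _] := pD; apply: uD.
exists f.
  (* Consecutive pieces share a vertex of [H]; with equal colours, two vertices of different
     components would have the same image under [F]. *)
  apply/forallP => i; apply/forallP => j; apply/implyP => /eqP ij; apply/eqP => fij.
  have : (D' i).1 :&: (D' j).1 != set0.
    by rewrite eD; have [_ _ -> _] := pD; rewrite -ij leqnn andbT; lia.
  case/set0Pn=> a; rewrite inE !ffunE => /andP[/imsetP[x _ ->] /imsetP[y _ xy]].
  have /Fi/(congr1 tag) /= : F (tg i x) = F (tg j y) by rewrite !FE fij xy.
  by move/(congr1 val) => /= e; lia.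
rewrite [s]surjective_pairing /spread; congr (_, _).
  rewrite -Fs; apply/setP=> x; apply/imsetP/bigcupP => [[[i a] _ ->]|[i _ /imsetP[a]]].
    by exists i => //; rewrite -[existT _ i a]/(tg i a) FE imset_f // -eD.
  by rewrite -eD ffunE => /imsetP[b _ ->] ->; exists (tg i b); rewrite ?FE.
apply/setP=> -[x y]; apply/idP/spread_edgeP => [/sE[i [a [b [-> -> ab]]]]|].
  exists i, (g i a), (g i b); rewrite !FE; split=> //.
  by rewrite -eD; apply/D'P; exists a, b.
case=> i [a [b [ab -> ->]]]; move: ab; rewrite -eD => /D'P[x' [y' [-> -> xy]]].
by rewrite -!FE -Fa tgadj.
Qed.
End Copies.

(** * Exponential decay over the reals *)

Local Open Scope R_scope.

Lemma pow_le_inv (x y : R) (M : nat) : (0 < M)%N -> 0 <= y -> x ^ M <= y ^ M -> x <= y.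
Proof.
move=> M0 y0 le; case: (Rle_lt_dec x y) => // yx; exfalso.
case: M M0 le => // M _; elim: M => [|M IHM] /= le; first lra.
apply: IHM => /=; case: (Rle_lt_dec (x * x ^ M) (y * y ^ M)) => // lt.
have : y * (y * y ^ M) < x * (x * x ^ M); last by lra.
have : 0 <= y * y ^ M by apply: (pow_le _ M.+1).
move=> h; apply: (Rle_lt_trans _ (y * (x * x ^ M))).
  by apply: Rmult_le_compat_l => //; lra.
by apply: Rmult_lt_compat_r => //; lra.
Qed.

(** [M] will be the power produced by the repeated squarings, [h] the order of the gluing, and the
    division by [q] prepares the sum over the residues. *)
Lemma exp_decay (M h q : nat) (K rho : R) : (0 < M)%N -> (0 < h)%N -> (0 < q)%N ->
  0 < rho -> rho < 1 -> 0 <= K ->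
  exists c : R, 0 < c /\ exists n0 : nat, forall n : nat, (n0 <= n)%N ->
    forall x, 0 <= x -> x ^ M <= K * rho ^ (n %/ h) -> x <= Rpower 2 (- (c * INR n)) / INR q.
Proof.
move=> M0 h0 q0 r0 r1 K0.
have M0' : 0 < INR M by apply: lt_0_INR; apply/ltP.
have h0' : 0 < INR h by apply: lt_0_INR; apply/ltP.
have q0' : 0 < INR q by apply: lt_0_INR; apply/ltP.
have l2 : 0 < ln 2 by rewrite -ln_1; apply: ln_increasing; lra.
pose lam := - ln rho.
have lam0 : 0 < lam.
  have := ln_increasing _ _ r0 r1; rewrite ln_1 /lam; lra.
(* Half of the available rate. The other half absorbs [L], that is [K], the factor [q ^ M], and the
   factor [1 / rho] lost by rounding [n / h] down. *)
pose c := lam / (2 * INR h * INR M * ln 2).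
have c0 : 0 < c by apply: Rdiv_lt_0_compat => //; repeat apply: Rmult_lt_0_compat => //; lra.
exists c; split=> //.
pose L := K * INR q ^ M / rho.
have qM : 0 < INR q ^ M by apply: pow_lt.
have L0 : 0 <= L by apply: Rmult_le_pos; [apply: Rmult_le_pos; lra|apply/Rlt_le/Rinv_0_lt_compat].
have [n0 n0P] := INR_unbounded (L * (2 * INR h) / lam).
exists n0 => n /leP/le_INR nn x x0 xM.
have nL : L <= exp (lam * INR n / (2 * INR h)).
  apply: (Rle_trans _ (lam * INR n / (2 * INR h))); last first.
    by have := exp_ineq1_le (lam * INR n / (2 * INR h)); lra.
  have -> : L = lam * (L * (2 * INR h) / lam) / (2 * INR h) by field; lra.
  apply: Rmult_le_compat_r; first by apply/Rlt_le/Rinv_0_lt_compat; lra.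
  by apply: Rmult_le_compat_l; lra.
set y := Rpower 2 (- (c * INR n)).
have y0 : 0 < y by apply: exp_pos.
have yM : y ^ M = exp (- (lam * INR n / (2 * INR h))).
  rewrite -(Rpower_pow M y) // /Rpower ln_exp; congr exp.
  by rewrite /c; field; lra.
apply: (pow_le_inv M0); first by apply: Rmult_le_pos; [lra|apply/Rlt_le/Rinv_0_lt_compat].
apply: (Rle_trans _ _ _ xM).
have -> : (y / INR q) ^ M = y ^ M / INR q ^ M.
  by rewrite /Rdiv Rpow_mult_distr pow_inv.
apply: (Rmult_le_reg_r (INR q ^ M)) => //.
have -> : y ^ M / INR q ^ M * INR q ^ M = y ^ M by field; lra.
have fl : INR n / INR h - 1 <= INR (n %/ h).
  apply: (Rmult_le_reg_r (INR h)) => //.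
  have -> : (INR n / INR h - 1) * INR h = INR n - INR h by field; lra.
  have /ltP/lt_INR : (n < (n %/ h).+1 * h)%N by apply: ltn_ceil.
  by rewrite -multE mult_INR S_INR; lra.
have rr : rho ^ (n %/ h) <= exp (- (lam * INR n / INR h)) / rho.
  rewrite -(Rpower_pow _ _ r0) /Rpower.
  have -> : exp (- (lam * INR n / INR h)) / rho = exp ((INR n / INR h - 1) * ln rho).
    rewrite -{1}(exp_ln rho) // /Rdiv -exp_Ropp -exp_plus; congr exp; rewrite /lam; field; lra.
  have le : INR (n %/ h) * ln rho <= (INR n / INR h - 1) * ln rho.
    have : 0 <= lam * (INR (n %/ h) - (INR n / INR h - 1)) by apply: Rmult_le_pos; lra.
    rewrite /lam; lra.
  by case: le => [/exp_increasing|->]; lra.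
rewrite yM.
apply: (Rle_trans _ (L * exp (- (lam * INR n / INR h)))).
  have -> : L * exp (- (lam * INR n / INR h)) = K * INR q ^ M * (exp (- (lam * INR n / INR h)) / rho).
    by rewrite /L; field; lra.
  rewrite (Rmult_assoc K) (Rmult_comm _ (INR q ^ M)) -Rmult_assoc.
  by apply: Rmult_le_compat_l => //; apply: Rmult_le_pos; lra.
apply: (Rle_trans _ (exp (lam * INR n / (2 * INR h)) * exp (- (lam * INR n / INR h)))).
  by apply: Rmult_le_compat_r => //; apply/Rlt_le/exp_pos.
rewrite -exp_plus; apply: Req_le; congr exp; field; lra.
Qed.

Local Close Scope R_scope.

From mathcomp Require Import all_order all_algebra ring.
From mathcomp Require Import cyclic separable cyclotomic complex Rstruct.
Import Order.TTheory GRing.Theory Num.Theory.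
Local Open Scope ring_scope.

(** * Random sets and the box norm *)

Section RandomSet.
Variables (C : numClosedFieldType) (T : finType) (U : {set T}) (p : C).
Hypotheses (p0 : 0 < p) (p1 : p < 1).
Implicit Types (x y z B : {set T}).

(* The resulting weight [wt] vanishes on the sets not contained in [U]. *)
Definition bern (t : T) (b : bool) : C :=
  if t \in U then (if b then p else 1 - p) else (~~ b)%:R.
Definition wt x : C := \prod_t bern t (t \in x).
Definition Ex (f : {set T} -> C) : C := \sum_x wt x * f x.
Definition mix B x y : {set T} := (x :\: B) :|: (y :&: B).

Lemma mu_ge0 t b : 0 <= bern t b.
Proof. by rewrite /bern; case: ifP => // _; case: b; rewrite ?ltW // subr_gt0. Qed.

Lemma wt_ge0 x : 0 <= wt x.
Proof. by apply: prodr_ge0 => t _; apply: mu_ge0. Qed.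

Lemma sum_prod_set (F : T -> bool -> C) :
  \sum_(x : {set T}) \prod_t F t (t \in x) = \prod_t (F t true + F t false).
Proof.
rewrite bigA_distr; apply: eq_bigr => x _; apply: eq_bigr => t _.
by case: (t \in x).
Qed.

Lemma mu_sum t : bern t true + bern t false = 1.
Proof. by rewrite /bern; case: ifP => _; rewrite ?add0r // addrC subrK. Qed.

Lemma wt_sum : \sum_x wt x = 1.
Proof. by rewrite sum_prod_set big1 // => t _; apply: mu_sum. Qed.

Lemma Ex_cst c : Ex (fun=> c) = c.
Proof. by rewrite /Ex -mulr_suml wt_sum mul1r. Qed.

Lemma eq_Ex f g : f =1 g -> Ex f = Ex g.
Proof. by move=> fg; apply: eq_bigr => x _; rewrite fg. Qed.

Lemma ExD f g : Ex (fun x => f x + g x) = Ex f + Ex g.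
Proof. by rewrite /Ex -big_split; apply: eq_bigr => x _; rewrite mulrDr. Qed.

Lemma ExZ c f : Ex (fun x => c * f x) = c * Ex f.
Proof. by rewrite /Ex mulr_sumr; apply: eq_bigr => x _; rewrite mulrCA. Qed.

Lemma ExZr c f : Ex (fun x => f x * c) = Ex f * c.
Proof. by rewrite /Ex mulr_suml; apply: eq_bigr => x _; rewrite mulrA. Qed.

Lemma Ex_conj f : (Ex f)^* = Ex (fun x => (f x)^*).
Proof.
rewrite /Ex rmorph_sum; apply: eq_bigr => x _; rewrite rmorphM /=.
by congr (_ * _); apply: geC0_conj; apply: wt_ge0.
Qed.

Lemma Ex_sum (I : Type) (r : seq I) (P : pred I) (F : I -> {set T} -> C) :
  Ex (fun x => \sum_(i <- r | P i) F i x) = \sum_(i <- r | P i) Ex (F i).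
Proof. by rewrite /Ex exchange_big; apply: eq_bigr => x _; rewrite mulr_sumr. Qed.

Lemma Ex_swap (F : {set T} -> {set T} -> C) :
  Ex (fun x => Ex (F x)) = Ex (fun y => Ex (fun x => F x y)).
Proof.
rewrite /Ex; under eq_bigr do rewrite mulr_sumr.
rewrite exchange_big; apply: eq_bigr => y _; rewrite mulr_sumr.
by apply: eq_bigr => x _; rewrite mulrCA.
Qed.

Lemma Ex_le f g : (forall x, f x <= g x) -> Ex f <= Ex g.
Proof. by move=> fg; apply: ler_sum => x _; rewrite ler_wpM2l ?wt_ge0. Qed.

Lemma Ex_norm f : `|Ex f| <= Ex (fun x => `|f x|).
Proof.
apply: le_trans (ler_norm_sum _ _ _) _; apply: ler_sum => x _.
by rewrite normrM ger0_norm ?wt_ge0.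
Qed.

Lemma mix_wt B x y : wt x * wt y = wt (mix B x y) * wt (mix B y x).
Proof.
rewrite /wt -!big_split; apply: eq_bigr => t _ /=.
by rewrite !inE; case: (t \in B) => /=; rewrite ?andbF ?andbT ?orbF //= mulrC.
Qed.

Lemma mix_mix B x y : mix B (mix B x y) (mix B y x) = x.
Proof. by apply/setP=> t; rewrite !inE; do !case: (_ \in _). Qed.

(** Exchanging the parts inside [B] is a weight-preserving involution on pairs of sets, so
    resampling inside [B] keeps the distribution. *)
Lemma Ex_mix B f : Ex (fun x => Ex (fun y => f (mix B x y))) = Ex f.
Proof.
have -> : Ex f = Ex (fun x => Ex (fun=> f x)) by apply: eq_Ex => x; rewrite Ex_cst.
rewrite /Ex; under eq_bigr do rewrite mulr_sumr.
under [RHS]eq_bigr do rewrite mulr_sumr.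
rewrite !pair_big /=.
rewrite [RHS](reindex_inj (h := fun u => (mix B u.1 u.2, mix B u.2 u.1))) /=; last first.
  by apply: (can_inj (g := fun u => (mix B u.1 u.2, mix B u.2 u.1))) => -[x y] /=; rewrite !mix_mix.
by apply: eq_bigr => -[x y] _ /=; rewrite !mulrA (mix_wt B x y).
Qed.

Lemma Ex_CS f : `|Ex f| ^+ 2 <= Ex (fun x => `|f x| ^+ 2).
Proof.
set m := Ex f; rewrite -subr_ge0.
have -> : Ex (fun x => `|f x| ^+ 2) - `|m| ^+ 2 = Ex (fun x => `|f x - m| ^+ 2).
  transitivity (Ex (fun x => `|f x| ^+ 2 + (- m^* * f x + (- m * (f x)^* + m * m^*)))).
    by rewrite !ExD !ExZ Ex_cst -Ex_conj -/m normCK mulNr mulNr; ring.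
  apply: eq_Ex => x; rewrite !normCK rmorphB /=; ring.
by rewrite -(Ex_cst 0); apply: Ex_le => x; rewrite exprn_ge0.
Qed.

Lemma mix_mixl B x y z : mix B (mix B x y) z = mix B x z.
Proof. by apply/setP=> t; rewrite !inE; do !case: (_ \in _). Qed.

Lemma mix_mixr B x y z : mix B x (mix B y z) = mix B x z.
Proof. by apply/setP=> t; rewrite !inE; do !case: (_ \in _). Qed.

(** Cauchy-Schwarz over the part outside [B]: the square of the inner average involves two
    independent samples inside [B] with a common outside. *)
Lemma Ex_CS_mix B (G : {set T} -> C) :
  `|Ex G| ^+ 2 <= Ex (fun x => Ex (fun y => G x * (G (mix B x y))^*)).
Proof.
rewrite -(Ex_mix B G); apply: le_trans (Ex_CS _) _.
rewrite -(Ex_mix B (fun x => Ex (fun y => G x * (G (mix B x y))^*))).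
apply: Ex_le => x; rewrite normCK Ex_conj -ExZr le_eqVlt; apply/orP; left; apply/eqP.
by apply: eq_Ex => y; rewrite -ExZ; apply: eq_Ex => z; rewrite mix_mixl.
Qed.

Definition E2 (F : {set T} -> {set T} -> C) : C := Ex (fun x => Ex (F x)).

Lemma eq_E2 F G : F =2 G -> E2 F = E2 G.
Proof. by move=> FG; apply: eq_Ex => x; apply: eq_Ex => y. Qed.

Lemma E2_le F G : (forall x y, F x y <= G x y) -> E2 F <= E2 G.
Proof. by move=> FG; apply: Ex_le => x; apply: Ex_le. Qed.

Lemma E2_cst c : E2 (fun _ _ => c) = c.
Proof. by rewrite /E2 !Ex_cst. Qed.

Lemma E2_norm F : `|E2 F| <= E2 (fun x y => `|F x y|).
Proof. by apply: le_trans (Ex_norm _) (Ex_le _) => x; apply: Ex_norm. Qed.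

Lemma E2_mix B F :
  E2 (fun x y => E2 (fun x' y' => F (mix B x x') (mix B y y'))) = E2 F.
Proof.
rewrite /E2; under eq_Ex do rewrite Ex_swap.
transitivity (Ex (fun x => Ex (fun x' => Ex (F (mix B x x'))))).
  by apply: eq_Ex => x; apply: eq_Ex => x'; rewrite Ex_mix.
exact: (Ex_mix B (fun x => Ex (F x))).
Qed.

Lemma norm1_conj (zeta : C) (n : int) : `|zeta| = 1 -> (zeta ^ n)^* = zeta ^ (- n).
Proof.
move=> z1; have zi : zeta^* = zeta^-1 by rewrite invC_norm z1 expr1n invr1 mul1r.
by case: n => m; rewrite ?NegzE ?opprK -?exprnN -?exprnP ?fmorphV rmorphXn /= zi ?exprVn // invrK.
Qed.

(** Each set [B m] costs one squaring. A single second sample [y] serves all steps: [D m] does not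
    read [y] inside [B m], so the new variable of step [m] is stored there. *)
Lemma box_norm (zeta : C) (d : nat) (B : nat -> {set T})
    (D : nat -> {set T} -> {set T} -> int) : `|zeta| = 1 ->
  (forall m x y z, (m < d)%N -> D m x (mix (B m) y z) = D m x y) ->
  (forall m x y, (m < d)%N -> D m.+1 x y = D m x y - D m (mix (B m) x y) y) ->
  `|E2 (fun x y => zeta ^ (D 0 x y))| ^+ (2 ^ d) <= `|E2 (fun x y => zeta ^ (D d x y))|.
Proof.
move=> z1 Dind Dstep; have z0 : zeta != 0 by rewrite -normr_eq0 z1 oner_neq0.
suff h m : (m <= d)%N ->
    `|E2 (fun x y => zeta ^ (D 0 x y))| ^+ (2 ^ m) <= `|E2 (fun x y => zeta ^ (D m x y))|.
  exact: h.
elim: m => [|m IHm] md; first by rewrite expr1.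
rewrite expnSr exprM; apply: le_trans (lerXn2r 2 _ _ (IHm (ltnW md))) _; rewrite ?nnegrE ?exprn_ge0 //.

have le : `|E2 (fun x y => zeta ^ (D m x y))| ^+ 2 <= E2 (fun x y => zeta ^ (D m.+1 x y)).
  rewrite /E2 Ex_swap; apply: le_trans (Ex_CS _) _.
  pose F y z := Ex (fun x => zeta ^ (D m x y) * (zeta ^ (D m (mix (B m) x z) y))^*).
  apply: (@le_trans _ _ (Ex (fun y => Ex (F y)))).
    by apply: Ex_le => y; apply: le_trans (Ex_CS_mix (B m) _) _; rewrite Ex_swap.
  rewrite [leRHS]Ex_swap -(Ex_mix (B m) (fun y => Ex (fun x => zeta ^ (D m.+1 x y)))).
  rewrite le_eqVlt; apply/orP; left; apply/eqP.
  apply: eq_Ex => y; apply: eq_Ex => z; apply: eq_Ex => x.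
  by rewrite Dstep // Dind // mix_mixr norm1_conj // -expfzDr // Dind.
(* The new average dominates a nonnegative number, so it is real and at most its own modulus. *)
by apply: (le_trans le); apply: real_ler_norm; rewrite realE (le_trans _ le) ?exprn_ge0.
Qed.

Definition dep B (F : {set T} -> {set T} -> C) :=
  forall x y x' y', x :&: B = x' :&: B -> y :&: B = y' :&: B -> F x y = F x' y'.

Lemma mix_in B x y : mix B x y :&: B = y :&: B.
Proof. by apply/setP=> t; rewrite !inE; do !case: (_ \in _). Qed.

Lemma mix_out B B' x y : [disjoint B & B'] -> mix B x y :&: B' = x :&: B'.
Proof.
move=> /pred0P dis; apply/setP=> t; have := dis t; rewrite !inE /=.
by do !case: (_ \in _).
Qed.

(** Resample both arguments inside [B]: then [F] sees only the new samples and [G] only the old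
    ones. *)
Lemma E2_indep B B' F G : [disjoint B & B'] -> dep B F -> dep B' G ->
  E2 (fun x y => F x y * G x y) = E2 F * E2 G.
Proof.
move=> dis dF dG; rewrite -(E2_mix B) mulrC.
rewrite /E2 -ExZr; apply: eq_Ex => x; rewrite -ExZr; apply: eq_Ex => y.
rewrite -ExZ; apply: eq_Ex => x'; rewrite -ExZ; apply: eq_Ex => y'.
rewrite mulrC; congr (_ * _); [apply: dG|apply: dF]; rewrite ?mix_in ?mix_out //.
Qed.

Lemma depS B B' F : B \subset B' -> dep B F -> dep B' F.
Proof.
move=> BB dF x y x' y' ex ey; apply: dF.
  by rewrite -(setIidPr BB) !setIA ex.
by rewrite -(setIidPr BB) !setIA ey.
Qed.

Lemma dep_prod (I : finType) (r : seq I) B (F : I -> {set T} -> {set T} -> C) :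
  (forall i, i \in r -> dep B (F i)) -> dep B (fun x y => \prod_(i <- r) F i x y).
Proof.
move=> dF x y x' y' ex ey; rewrite !big_seq; apply: eq_bigr => i ir.
exact: dF ex ey.
Qed.

Lemma E2_prod (I : finType) (B : I -> {set T}) (F : I -> {set T} -> {set T} -> C) :
  (forall i j, i != j -> [disjoint B i & B j]) -> (forall i, dep (B i) (F i)) ->
  E2 (fun x y => \prod_i F i x y) = \prod_i E2 (F i).
Proof.
move=> dis dF; rewrite -big_enum /=.
transitivity (E2 (fun x y => \prod_(i <- enum I) F i x y)).
  by apply: eq_E2 => x y; rewrite -big_enum.
elim: (enum I) (enum_uniq I) => [_|i r IHr /= /andP[ir ur]].
  by rewrite big_nil -[RHS]E2_cst; apply: eq_E2 => x y; rewrite big_nil.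
rewrite big_cons -IHr // -(@E2_indep (B i) (\bigcup_(j in r) B j)) //.
- by apply: eq_E2 => x y; rewrite big_cons.
- apply: bigcup_disjoint => j jr; apply: dis.
  by apply: contraNneq ir => ->.
- apply: dep_prod => j jr; apply: depS (dF j).
  exact: (bigcup_sup j).
Qed.

Lemma Ex_inter (W X : {set T}) : X \subset W ->
  Ex (fun x => (x :&: W == X)%:R) = \prod_(t in W) bern t (t \in X).
Proof.
move=> XW; pose F t b := bern t b * (if t \in W then (b == (t \in X))%:R else 1).
transitivity (\sum_(x : {set T}) \prod_t F t (t \in x)).
  apply: eq_bigr => x _; rewrite big_split /= -/(wt x); congr (_ * _).
  have [e|ne] := eqVneq (x :&: W) X.
    rewrite big1 // => t _; case: ifP => // tW.
    by rewrite -e inE tW andbT eqxx.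
  have [t /andP[tW nt]] : exists t, (t \in W) && ((t \in x) != (t \in X)).
    apply/existsP; apply: contraT => /existsPn no; case/eqP: ne; apply/setP=> t.
    rewrite inE; have := no t; rewrite negb_and negbK; case: (boolP (t \in W)) => [_ /eqP ->|tW _].
      by rewrite andbT.
    by rewrite andbF; apply/esym/negbTE; apply: contraNN tW; apply: (subsetP XW).
  by rewrite (bigD1 t) //= tW (negPf nt) mul0r.
rewrite sum_prod_set [RHS]big_mkcond; apply: eq_bigr => t _; rewrite /F.
case: ifP => tW; last by rewrite !mulr1 mu_sum.
by case: (t \in X); rewrite /= mulr1 mulr0 ?addr0 ?add0r.
Qed.

Lemma Ex_inter_ge (d : nat) (W X : {set T}) : X \subset W -> W \subset U -> (#|W| <= d)%N ->
  (p * (1 - p)) ^+ d <= Ex (fun x => (x :&: W == X)%:R).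
Proof.
move=> XW WU Wd; rewrite Ex_inter //.
have q0 : 0 <= 1 - p by rewrite subr_ge0 ltW.
have q1 : 1 - p <= 1 by rewrite lerBlDr lerDl ltW.
have pq0 : 0 <= p * (1 - p) by rewrite mulr_ge0 // ltW.
apply: (@le_trans _ _ ((p * (1 - p)) ^+ #|W|)).
  by apply: ler_wiXn2l => //; rewrite mulr_ile1 // ltW.
rewrite -prodr_const; apply: ler_prod => t tW; rewrite pq0 /bern (subsetP WU _ tW).
case: (t \in X); first by rewrite ler_piMr // ltW.
by rewrite ler_piMl // ltW.
Qed.

(** With [y] empty on [W], the differences of edge indicators in [W] become the indicator of [X], so
    any 0/1 pattern of increments can be prescribed. The two factors are the costs of fixing [x] and
    [y] on at most [d] edges. *)
Lemma E2_pattern (d : nat) (W X : {set T}) : X \subset W -> W \subset U -> (#|W| <= d)%N ->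
  (p * (1 - p)) ^+ d ^+ 2 <= E2 (fun x y => ((x :&: W == X) && (y :&: W == set0))%:R).
Proof.
move=> XW WU Wd; pose f V x : C := (x :&: W == V)%:R.
have -> : E2 (fun x y => ((x :&: W == X) && (y :&: W == set0))%:R) = Ex (f X) * Ex (f set0).
  by rewrite -ExZr; apply: eq_Ex => x; rewrite -ExZ; apply: eq_Ex => y; rewrite -natrM mulnb.
have pq0 : 0 <= (p * (1 - p)) ^+ d.
  by rewrite exprn_ge0 // mulr_ge0 ?subr_ge0 ?ltW.
rewrite expr2; apply: ler_pM => //; apply: Ex_inter_ge => //; exact: sub0set.
Qed.

End RandomSet.

(** * Sums over proper colourings of a path *)

Section PathSum.
Variable r : nat.

Definition ffrcons k (g : {ffun 'I_k -> 'I_r}) (a : 'I_r) : {ffun 'I_k.+1 -> 'I_r} :=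
  [ffun i => if unlift ord_max i is Some i' then g i' else a].

Lemma ffrcons_max k (g : {ffun 'I_k -> 'I_r}) a : ffrcons g a ord_max = a.
Proof. by rewrite ffunE unlift_none. Qed.

Lemma ffrcons_lift k (g : {ffun 'I_k -> 'I_r}) a i : ffrcons g a (lift ord_max i) = g i.
Proof. by rewrite ffunE liftK. Qed.

Lemma sum_ffrcons k (R : nmodType) (F : {ffun 'I_k.+1 -> 'I_r} -> R) :
  \sum_f F f = \sum_g \sum_a F (ffrcons g a).
Proof.
rewrite pair_big /= (reindex (fun u => ffrcons u.1 u.2)) //=.
exists (fun f : {ffun 'I_k.+1 -> 'I_r} => ([ffun i => f (lift ord_max i)], f ord_max)) => [[g a]|f] _ /=.
  rewrite ffrcons_max; congr (_, _); apply/ffunP => i; by rewrite ffunE ffrcons_lift.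
by apply/ffunP => i; rewrite ffunE; case: unliftP => [j ->|->//]; rewrite ffunE.
Qed.

Lemma proper_ffrcons k (g : {ffun 'I_k.+1 -> 'I_r}) a :
  proper_col (ffrcons g a) = proper_col g && (g ord_max != a).
Proof.
have lv (i : 'I_k.+1) : lift ord_max i = i :> nat by rewrite lift_max.
apply/idP/andP => [/forallP h|[/forallP h ga]].
  split; last first.
    have /forallP/(_ ord_max) := h (lift ord_max ord_max).
    by rewrite lv eqxx ffrcons_lift ffrcons_max.
  apply/forallP => i; apply/forallP => j.
  by have /forallP/(_ (lift ord_max j)) := h (lift ord_max i); rewrite !lv !ffrcons_lift.
apply/forallP => i; apply/forallP => j; apply/implyP => /eqP.
case: (unliftP ord_max i) => [i' ->|->]; case: (unliftP ord_max j) => [j' ->|->]; rewrite ?lv.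
- by move=> e; rewrite !ffrcons_lift; have /forallP/(_ j')/implyP := h i'; apply; rewrite e.
- move=> [e]; rewrite ffrcons_lift ffrcons_max.
  by have -> : i' = ord_max by apply: val_inj.
- by move=> e; have := ltn_ord j'; rewrite -[X in (X < _)%N]e /=; lia.
- by move=> /= e; exfalso; lia.
Qed.

(** Transfer recursion: for [0 < i] this is the weighted count of proper colourings of the first [i]
    vertices of the path whose last colour is not [j], computed as the total minus those ending in
    [j]. *)
Fixpoint link (P : nat -> 'I_r -> int) (i : nat) (j : 'I_r) : int :=
  if i is i'.+1 then \sum_j' P i' j' * link P i' j' - P i' j * link P i' j else 1.

Lemma sum_proper_col (P : nat -> 'I_r -> int) (k : nat) (j : 'I_r) :
  \sum_(f : {ffun 'I_k.+1 -> 'I_r} | proper_col f && (f ord_max == j)) \prod_(i < k.+1) P i (f i) =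
  P k j * link P k j.
Proof.
elim: k j => [|k IHk] j; rewrite big_mkcond sum_ffrcons /=.
  rewrite (bigD1 [ffun=> j]) //= [X in _ + X]big1 ?addr0 => [|g gn]; last first.
    by case/eqP: gn; apply/ffunP => i; case: (i) => m m0; case: (notF (etrans (esym (ltn0 m)) m0)).
  rewrite (bigD1 j) //= [X in _ + X]big1 ?addr0 => [|a aj]; last by rewrite ffrcons_max (negPf aj) andbF.
  rewrite ffrcons_max eqxx andbT big_ord1 (_ : ord0 = ord_max) ?ffrcons_max; last exact: val_inj.
  rewrite mulr1; case: ifP => // /negP[]; apply/forallP => a; apply/forallP => b.
  by rewrite (ord1 a) (ord1 b).
transitivity (\sum_(g : {ffun 'I_k.+1 -> 'I_r} | proper_col g && (g ord_max != j))
   (\prod_(i < k.+1) P i (g i)) * P k.+1 j).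
  rewrite [RHS]big_mkcond; apply: eq_bigr => g _.
  rewrite (bigD1 j) //= [X in _ + X]big1 ?addr0 => [|a aj]; last by rewrite ffrcons_max (negPf aj) andbF.
  rewrite ffrcons_max eqxx andbT proper_ffrcons; case: ifP => // _.
  rewrite big_ord_recr /= ffrcons_max; congr (_ * _); apply: eq_bigr => i _.
  have -> : widen_ord (leqnSn k.+1) i = lift ord_max i by apply: val_inj; rewrite [RHS]lift_max.
  by rewrite ffrcons_lift.
rewrite -mulr_suml mulrC; congr (_ * _).
have e : \sum_(f : {ffun 'I_k.+1 -> 'I_r} | proper_col f) \prod_(i < k.+1) P i (f i) =
   \sum_j' P k j' * link P k j'.
  rewrite (partition_big (fun f : {ffun 'I_k.+1 -> 'I_r} => f ord_max) xpredT) //=.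
  by apply: eq_bigr => j' _; rewrite IHk.
by rewrite /= -e -IHk [in RHS](bigID (fun f : {ffun 'I_k.+1 -> 'I_r} => f ord_max == j)) /= addrC addrK.
Qed.

Lemma sum_proper_link (P : nat -> 'I_r -> int) (k : nat) :
  \sum_(f : {ffun 'I_k.+1 -> 'I_r} | proper_col f) \prod_(i < k.+1) P i (f i) =
  \sum_j P k j * link P k j.
Proof.
rewrite (partition_big (fun f : {ffun 'I_k.+1 -> 'I_r} => f ord_max) xpredT) //=.
by apply: eq_bigr => j' _; rewrite sum_proper_col.
Qed.

Lemma eq_link (P P' : nat -> 'I_r -> int) k :
  (forall i, (i < k)%N -> P i =1 P' i) -> link P k =1 link P' k.
Proof.
elim: k => // k IHk PP j /=; have e := IHk (fun i ik => PP i (ltnW ik)).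
rewrite PP // e; congr (_ - _); apply: eq_bigr => j' _; by rewrite PP // e.
Qed.
End PathSum.

(* [ell s u] is [link] with the global sums frozen to the values [s], see [link_ell]. *)
Fixpoint ell (s u : nat -> int) (i : nat) : int :=
  if i is i'.+1 then s i' - u i' * ell s u i' else 1.

Lemma link_ell r (P : nat -> 'I_r -> int) k j :
  link P k j = ell (fun i => \sum_j' P i j' * link P i j') (P^~ j) k.
Proof. by elim: k => //= k <-. Qed.

Lemma eq_ell (s u u' : nat -> int) k : (forall i, (i < k)%N -> u i = u' i) -> ell s u k = ell s u' k.
Proof.
elim: k => //= k IHk e; rewrite e // IHk // => i ik; exact: e (ltnW ik).
Qed.

Lemma norm_unity_root (C : numClosedFieldType) (z : C) (q : nat) :
  (0 < q)%N -> z ^+ q = 1 -> `|z| = 1.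
Proof.
move=> q0 zq; apply/eqP; have : `|z| ^+ q == 1 by rewrite -normrX zq normr1.
by rewrite -[X in _ == X](expr1n _ q) eqrXn2 // ler01.
Qed.

Section RootPow.
Variables (C : numClosedFieldType) (zeta : C).
Hypothesis (z0 : zeta != 0).

(** Each frozen sum enters only through a power of [zeta], so for a [q]-th root of unity only
    [q ^ k] cases remain. *)
Lemma eq_zeta_ell (s s' u : nat -> int) k :
  (forall i, (i < k)%N -> zeta ^ (s i) = zeta ^ (s' i)) -> zeta ^ (ell s u k) = zeta ^ (ell s' u k).
Proof.
elim: k => //= k IHk e; rewrite !expfzDr // e // -!mulNr ![- _ * _]mulrC -!exprz_exp IHk // => i ik.
exact: e (ltnW ik).
Qed.

Lemma ell_neq1 (s : nat -> int) k : zeta != 1 ->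
  exists u : nat -> bool, zeta ^ (ell s (fun i => (u i : nat)%:Z) k) != 1.
Proof.
move=> z1; elim: k => [|k [u hu]]; first by exists xpredT; rewrite /= expr1z.
have [sk|sk] := eqVneq (zeta ^ (s k)) 1; last first.
  by exists (fun i => (i != k) && u i); rewrite /= eqxx /= mul0r subr0.
exists (fun i => (i == k) || u i); rewrite /= eqxx mul1r expfzDr // sk mul1r -invr_expz invr_eq1.
rewrite (@eq_ell _ _ (fun i => (u i : nat)%:Z)) // => i ik.
by rewrite ltn_eqF.
Qed.
End RootPow.

Lemma expz_sum (C : fieldType) (zeta : C) (I : finType) (F : I -> int) : zeta != 0 ->
  zeta ^ (\sum_i F i) = \prod_i zeta ^ (F i).
Proof.
move=> z0; apply: (big_morph (fun n : int => zeta ^ n)) => [a b|]; [exact: expfzDr|exact: expr0z].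
Qed.

(** * Averaging the path sum over independent copies *)

Section Average.
Variables (C : numClosedFieldType) (T : finType) (U : {set T}) (p : C).
Hypotheses (p0 : 0 < p) (p1 : p < 1).
Variables (r k d q : nat) (W : nat -> 'I_r -> {set T}).
Hypothesis Wdis : forall i j i' j', (i, j) != (i', j') -> [disjoint W i j & W i' j'].
Hypothesis WU : forall i j, W i j \subset U.
Hypothesis W0 : forall i j, (i <= k)%N -> W i j != set0.
Hypothesis Wd : forall j, (#|\bigcup_(i < k.+1) W i j| <= d)%N.
Variables (zeta delta : C).
Hypotheses (q0 : (0 < q)%N) (zq : zeta ^+ q = 1) (z1 : zeta != 1).
Hypotheses (de0 : 0 < delta) (de1 : delta <= 1).
Hypothesis zde : forall n : int, zeta ^ n != 1 -> `|1 + zeta ^ n| <= 2 - delta.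

Notation EE := (E2 U p).
Let beta : C := (p * (1 - p)) ^+ d ^+ 2.
Let rho : C := 1 - beta * delta.

(** The iterated difference, edge by edge, of the indicator that [W] lies in the sample. *)
Definition incr (W : {set T}) (x y : {set T}) : int :=
  \prod_(t in W) ((t \in x)%:Z - (t \in y)%:Z).

Lemma incr_dep (V x y x' y' : {set T}) : x :&: V = x' :&: V -> y :&: V = y' :&: V ->
  incr V x y = incr V x' y'.
Proof.
move=> ex ey; apply: eq_bigr => t tV.
have := congr1 (fun X : {set T} => t \in X) ex; have := congr1 (fun X : {set T} => t \in X) ey.
by rewrite /= !inE tV !andbT => -> ->.
Qed.

Lemma incr_pattern1 (V V' X x y : {set T}) : V \subset X -> X \subset V' ->
  (x :&: V' == X) && (y :&: V' == set0) -> incr V x y = 1.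
Proof.
move=> VX XV /andP[/eqP ex /eqP ey]; rewrite /incr big1 // => t /(subsetP VX) tX.
have tV := subsetP XV _ tX; move: tX; rewrite -ex inE tV andbT => ->.
have := congr1 (fun X : {set T} => t \in X) ey.
by rewrite /= !inE tV andbT => ->.
Qed.

Lemma incr_pattern0 (V V' X x y : {set T}) : [disjoint V & X] -> V \subset V' -> V != set0 ->
  (x :&: V' == X) && (y :&: V' == set0) -> incr V x y = 0.
Proof.
move=> dis VV /set0Pn[t tV] /andP[/eqP ex /eqP ey]; rewrite /incr (bigD1 t) //=.
have tV' := subsetP VV _ tV.
have := congr1 (fun X : {set T} => t \in X) ey; rewrite /= !inE tV' andbT => ->.
have := congr1 (fun X : {set T} => t \in X) ex; rewrite /= !inE tV' andbT => ->.
by rewrite (disjointFr dis tV) subrr mul0r.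
Qed.

Let pq0 : 0 < p * (1 - p). Proof. by rewrite mulr_gt0 // subr_gt0. Qed.
Let pq1 : p * (1 - p) <= 1.
Proof. by rewrite mulr_ile1 ?subr_ge0 ?ltW // ltrBlDr ltrDl. Qed.
Let beta0 : 0 < beta. Proof. by rewrite !exprn_gt0. Qed.
Let beta1 : beta <= 1. Proof. by rewrite !exprn_ile1 ?exprn_ge0 // ltW. Qed.
Let rho1 : rho <= 1. Proof. by rewrite /rho lerBlDr lerDl mulr_ge0 // ltW. Qed.
Let rho0 : 0 <= rho. Proof. by rewrite /rho subr_ge0 mulr_ile1 // ltW. Qed.
Let z_n0 : zeta != 0.
Proof. by apply: contra_eq_neq zq => ->; rewrite expr0n gtn_eqF // eq_sym oner_neq0. Qed.
Let zn1 : `|zeta| = 1. Proof. exact: norm_unity_root q0 zq. Qed.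
Let znX (n : int) : `|zeta ^ n| = 1.
Proof.
by case: n => n; rewrite ?NegzE -?exprnN ?normrV -?exprnP ?normrX ?zn1 ?expr1n ?invr1 ?unitfE ?expf_neq0.
Qed.

Let Wsub i j : (i < k.+1)%N -> W i j \subset \bigcup_(i < k.+1) W i j.
Proof. by move=> ik; apply: (bigcup_sup (Ordinal ik)). Qed.

(** Bound for the average over one increment of the last piece with coefficient [n]: no gain when
    [zeta ^ n = 1], the factor [rho] otherwise. *)
Definition damp (n : int) : C := if zeta ^ n == 1 then 1 else rho.

Lemma damp_ge0 n : 0 <= damp n. Proof. by rewrite /damp; case: ifP. Qed.
Lemma damp_le1 n : damp n <= 1. Proof. by rewrite /damp; case: ifP. Qed.

(** The increment takes each of the values 1 and 0 with probability at least [beta]. Pairing off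
    mass [beta] of each contributes at most [beta * (2 - delta)] in place of [2 * beta], which saves
    [beta * delta]. *)
Lemma E2_incr_le (V : {set T}) (l : int) : V \subset U -> V != set0 -> (#|V| <= d)%N ->
  `|EE (fun x y => zeta ^ (incr V x y * l))| <= damp l.
Proof.
move=> VU V0 Vd; rewrite /damp; case: ifPn => [/eqP zl|zl].
  apply: le_trans (E2_norm _ p0 p1 _) _; rewrite -[leRHS](E2_cst U p 1); apply: E2_le => // x y.
  by rewrite mulrC -exprz_exp zl exp1rz normr1.
pose a (X : {set T}) x y : C := ((x :&: V == X) && (y :&: V == set0))%:R.
pose A := EE (a V); pose B := EE (a set0).
have Age : beta <= A by apply: E2_pattern.
have Bge : beta <= B by apply: E2_pattern => //; apply: sub0set.
pose rest x y := zeta ^ (incr V x y * l) * (1 - a V x y - a set0 x y).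
have -> : EE (fun x y => zeta ^ (incr V x y * l)) = EE rest + (zeta ^ l * A + B).
  transitivity (EE (fun x y => rest x y + (zeta ^ l * a V x y + a set0 x y))).
    apply: eq_E2 => x y; rewrite /rest /a.
    case: (boolP (_ && _)) => [h|_]; case: (boolP (_ && _)) => [h'|_] /=; rewrite ?mulr1n ?mulr0n.
    - by case/andP: h h' V0 => /eqP-> _ /andP[/eqP-> _]; rewrite eqxx.
    - by rewrite (incr_pattern1 _ _ h) // mul1r; ring.
    - by rewrite (incr_pattern0 _ _ V0 h') ?mul0r ?expr0z -?setI_eq0 ?setI0 //; ring.
    - by ring.
  rewrite /A /B; rewrite /E2; under eq_Ex do rewrite ExD ExD ExZ.
  by rewrite ExD ExD ExZ.
have le1 : `|EE rest| <= 1 - A - B.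
  apply: le_trans (E2_norm _ p0 p1 _) _.
  have -> : 1 - A - B = EE (fun x y => 1 + ((-1) * a V x y + (-1) * a set0 x y)).
    rewrite /E2; under eq_Ex do rewrite !ExD !ExZ Ex_cst.
    by rewrite !ExD !ExZ Ex_cst -/(EE _) -/(EE _) !mulN1r addrA.
  apply: E2_le => // x y; rewrite normrM znX mul1r ger0_norm; last first.
    rewrite /a; case: (boolP (_ && _)) => [h|_]; case: (boolP (_ && _)) => [h'|_] //=.
    + by case/andP: h h' V0 => /eqP-> _ /andP[/eqP-> _]; rewrite eqxx.
    + by rewrite subrr subr0.
    + by rewrite subr0 subrr.
    + by rewrite !subr0 ler01.
  by rewrite !mulN1r addrA.
have le2 : `|zeta ^ l * A + B| <= (A - beta) + (B - beta) + beta * (2 - delta).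
  have -> : zeta ^ l * A + B = zeta ^ l * (A - beta) + (B - beta) + beta * (1 + zeta ^ l) by ring.
  apply: le_trans (ler_normD _ _) _; apply: lerD.
    apply: le_trans (ler_normD _ _) _.
    by rewrite normrM znX mul1r !ger0_norm ?subr_ge0.
  by rewrite normrM (gtr0_norm beta0) ler_pM2l //; apply: zde.
apply: le_trans (ler_normD _ _) _; apply: le_trans (lerD le1 le2) _.
by rewrite le_eqVlt; apply/orP; left; apply/eqP; rewrite /rho; ring.
Qed.

(** With probability at least [beta] copy [j] shows the pattern of [ell_neq1], and then [damp] saves
    [beta * delta]; hence the square of [beta]. *)
Lemma E2_damp_ell_le (s : nat -> int) j :
  EE (fun x y => damp (ell s (fun i => incr (W i j) x y) k)) <= 1 - beta ^+ 2 * delta.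
Proof.
have [u hu] := ell_neq1 z_n0 s k z1.
pose V := \bigcup_(i < k.+1) W i j.
pose X := \bigcup_(i < k.+1 | u i) W i j.
have XV : X \subset V.
  by apply/bigcupsP => i _; apply: (bigcup_sup i).
have VU : V \subset U by apply/bigcupsP => i _; apply: WU.
pose a x y : C := ((x :&: V == X) && (y :&: V == set0))%:R.
have ge : beta <= EE a by apply: E2_pattern => //; apply: Wd.
apply: (@le_trans _ _ (EE (fun x y => 1 + (- (beta * delta)) * a x y))).
  apply: E2_le => // x y; rewrite /a; case: (boolP (_ && _)) => [h|_]; last first.
    by rewrite mulr0 addr0; apply: damp_le1.
  rewrite mulr1 /damp (@eq_ell _ _ (fun i => (u i : nat)%:Z)) ?(negPf hu) // => i ik.
  have ik' : (i < k.+1)%N by rewrite ltnW.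
  have [ui|nui] /= := boolP (u i).
    by apply: (incr_pattern1 _ XV h); apply: (bigcup_sup (Ordinal ik')).
  apply: (incr_pattern0 _ _ _ h); rewrite ?Wsub ?W0 // 1?ltnW //.
  apply: bigcup_disjoint => i' ui'; apply: Wdis; apply: contraNneq nui => -[->].
  by [].
have -> : EE (fun x y => 1 + - (beta * delta) * a x y) = 1 - beta * delta * EE a.
  rewrite /E2; under eq_Ex do rewrite ExD ExZ Ex_cst.
  by rewrite ExD ExZ Ex_cst mulNr.
rewrite lerD2l lerN2 expr2 -mulrA [beta * delta * _]mulrAC mulrA ler_pM2r //.
by rewrite ler_pM2l.
Qed.

Definition path_sum (x y : {set T}) : int :=
  \sum_(f : {ffun 'I_k.+1 -> 'I_r} | proper_col f) \prod_(i < k.+1) incr (W i (f i)) x y.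

Lemma path_sum_bound :
  `|EE (fun x y => zeta ^ (path_sum x y))| <= q%:R ^+ k * (1 - beta ^+ 2 * delta) ^+ r.
Proof.
pose P x y i j := incr (W i j) x y.
pose L x y := link (P x y) k.
have kk : (k < k.+1)%N by [].
pose B := \bigcup_j W k j.
have inB j x y x' y' : P (mix B x x') (mix B y y') k j = P x' y' k j.
  have WB : W k j \subset B by apply: (bigcup_sup j).
  by apply: incr_dep; rewrite -(setIidPr WB) !setIA !mix_in.
have outB i j x y x' y' : (i < k)%N -> P (mix B x x') (mix B y y') i j = P x y i j.
  move=> ik; have dis : [disjoint B & W i j].
    rewrite disjoint_sym; apply: bigcup_disjoint => j' _; apply: Wdis.
    by rewrite xpair_eqE ltn_eqF.
  by apply: incr_dep; rewrite mix_out.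
(* averaging over the last piece first: the sum is linear in its increments *)
have step1 : `|EE (fun x y => zeta ^ (path_sum x y))| <= EE (fun x y => \prod_j damp (L x y j)).
  rewrite -(E2_mix U p B); apply: le_trans (E2_norm _ p0 p1 _) _; apply: E2_le => // x y.
  rewrite (@eq_E2 _ _ _ _ _ (fun x' y' => \prod_j zeta ^ (P x' y' k j * L x y j))); last first.
    move=> x' y'; rewrite /path_sum (sum_proper_link (P (mix B x x') (mix B y y'))) -expz_sum //.
    congr (_ ^ _); apply: eq_bigr => j _; rewrite inB; congr (_ * _).
    by apply: eq_link => i ik j'; apply: outB.
  rewrite (@E2_prod _ _ U p _ (W k)) //; last first.
  - by move=> j x1 y1 x2 y2 ex ey; rewrite /P (incr_dep ex ey).
  - by move=> j j' jj'; apply: Wdis; rewrite xpair_eqE negb_and jj' orbT.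
  rewrite normr_prod; apply: ler_prod => j _; rewrite normr_ge0 /=.
  apply: E2_incr_le; rewrite ?W0 //.
  exact: leq_trans (subset_leq_card (Wsub j kk)) (Wd j).
apply: le_trans step1 _.
(* union bound over the residues of the k partial sums *)
pose ex (s : {ffun 'I_k -> 'I_q}) (i : nat) : int := if insub i is Some i' then (s i' : nat)%:Z else 0.
apply: (@le_trans _ _ (EE (fun x y =>
   \sum_(s : {ffun 'I_k -> 'I_q}) \prod_j damp (ell (ex s) (fun i => P x y i j) k)))).
  apply: E2_le => // x y.
  pose S i := \sum_j' P x y i j' * link (P x y) i j'.
  have lt i : (`|(S i %% q)%Z| < q)%N by rewrite -ltz_nat gez0_abs ?modz_ge0 ?ltz_pmod // -lt0n.
  pose s0 : {ffun 'I_k -> 'I_q} := [ffun i : 'I_k => Ordinal (lt i)].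
  rewrite (bigD1 s0) //= -[leLHS]addr0; apply: lerD; last first.
    by apply: sumr_ge0 => s _; apply: prodr_ge0 => j _; apply: damp_ge0.
  apply: ler_prod => j _; rewrite damp_ge0 /= le_eqVlt; apply/orP; left; apply/eqP.
  rewrite /damp /L link_ell; congr (if _ == 1 then _ else _).
  apply: eq_zeta_ell => // i ik.
  rewrite /ex insubT /= ffunE /= gez0_abs ?modz_ge0 -?lt0n //.
  rewrite -/(S i) [in LHS](divz_eq (S i) q) expfzDr // [(_ * q%:Z)%R]mulrC.
  by rewrite -exprz_exp -exprnP zq exp1rz mul1r.
rewrite /E2; under eq_Ex do rewrite Ex_sum.
rewrite Ex_sum -/(EE _).
have -> : q%:R ^+ k = \sum_(s : {ffun 'I_k -> 'I_q}) 1 :> C.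
  by rewrite sumr_const card_ffun !card_ord natrX.
rewrite mulr_suml; apply: ler_sum => s _; rewrite mul1r.
rewrite -[leLHS]/(EE (fun x y => \prod_j damp (ell (ex s) (fun i => P x y i j) k))).
(* Once the sums are frozen, factor [j] reads only copy [j] of the gluing, so the average
   factors. *)
rewrite (@E2_prod _ _ U p _ (fun j => \bigcup_(i < k.+1) W i j)) //; last first.
- move=> j x1 y1 x2 y2 ex1 ey1; congr damp; apply: eq_ell => i ik.
  have sub := Wsub j (ltnW ik : (i < k.+1)%N).
  by apply: incr_dep; rewrite -(setIidPr sub) !setIA ?ex1 ?ey1.
- move=> j j' jj'; apply: bigcup_disjoint => i' _; rewrite disjoint_sym.
  apply: bigcup_disjoint => i _; apply: Wdis.
  by rewrite xpair_eqE negb_and ?jj' ?[j' == j]eq_sym ?jj' orbT.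
rewrite -[X in _ <= _ ^+ X](card_ord r) -prodr_const; apply: ler_prod => j _.
rewrite E2_damp_ell_le andbT -(E2_cst U p 0); apply: E2_le => // x y; exact: damp_ge0.
Qed.
End Average.

(** * Exponential sums of copy counts *)

Section Monomials.
Variables (T S : finType) (A : pred S) (u : S -> {set T}) (d : nat) (B : nat -> {set T}).
Hypothesis Bdis : forall m m', m != m' -> [disjoint B m & B m'].

(** It vanishes for empty [V], which is how copies that miss a class drop out. *)
Definition mon_diff (V x y : {set T}) : int := (V \subset x)%:Z - (V \subset y)%:Z.

(** Closed form of the iterated difference along the first [m] classes: each of them turns its part
    of a monomial into a difference, while the remaining edges keep their indicator in [x]. *)
Definition box_deriv (m : nat) (x y : {set T}) : int :=
  \sum_(s | A s) (u s :\: \bigcup_(i < m) B i \subset x)%:Z *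
     \prod_(i < m) mon_diff (u s :&: B i) x y.

Lemma sub_mix_in V m x y : (V :&: B m \subset mix (B m) x y) = (V :&: B m \subset y).
Proof.
apply/subsetP/subsetP => h t tV; have := h t tV; move: tV; rewrite !inE => /andP[_ ->];
  by rewrite ?andbF ?andbT ?orbF.
Qed.

Lemma sub_mix_out (V : {set T}) m x y : [disjoint V & B m] -> (V \subset mix (B m) x y) = (V \subset x).
Proof.
move=> dis; apply/subsetP/subsetP => h t tV; have := h t tV; rewrite !inE (disjointFr dis tV) /=;
  by rewrite ?andbF ?orbF.
Qed.

Lemma mon_diff_mixl V i m x y : i != m ->
  mon_diff (V :&: B i) (mix (B m) x y) y = mon_diff (V :&: B i) x y.
Proof.
move=> im; rewrite /mon_diff sub_mix_out //.
by apply: disjointWl (Bdis im); apply: subsetIr.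
Qed.

Lemma deriv_indep m x y z : box_deriv m x (mix (B m) y z) = box_deriv m x y.
Proof.
apply: eq_bigr => s _; congr (_ * _); apply: eq_bigr => i _.
rewrite /mon_diff sub_mix_out //; apply: disjointWl (Bdis _); first exact: subsetIr.
by rewrite neq_ltn ltn_ord.
Qed.

Lemma derivS m x y : box_deriv m.+1 x y = box_deriv m x y - box_deriv m (mix (B m) x y) y.
Proof.
rewrite /box_deriv -sumrB; apply: eq_bigr => s _; rewrite !big_ord_recr /= -setDDl.
have -> : \prod_(i < m) mon_diff (u s :&: B i) (mix (B m) x y) y =
          \prod_(i < m) mon_diff (u s :&: B i) x y.
  by apply: eq_bigr => i _; apply: mon_diff_mixl; rewrite neq_ltn ltn_ord.
set V := u s :\: \bigcup_(i < m) B i.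
have VB : V :&: B m = u s :&: B m.
  apply/setP=> t; rewrite !inE; case: (boolP (t \in B m)) => [tm|]; rewrite ?andbF // !andbT.
  case: bigcupP => // -[i _ ti]; have := Bdis (negbT (gtn_eqF (ltn_ord i))).
  by move/disjointFr => /(_ _ tm); rewrite ti.
have split (z : {set T}) : (V \subset z) = (V :\: B m \subset z) && (u s :&: B m \subset z).
  by rewrite -VB -subUset setUC setID.
rewrite (split x) (split (mix _ _ _)) sub_mix_in sub_mix_out; last first.
  by rewrite -setI_eq0; apply/eqP/setP=> t; rewrite !inE; case: (t \in B m); rewrite ?andbF.
rewrite /mon_diff; move: (\prod_(i < m) _) => X.
by do !case: (_ \subset _); rewrite /=; ring.
Qed.

Lemma box_norm_count (C : numClosedFieldType) (U : {set T}) (p zeta : C) :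
  0 < p -> p < 1 -> `|zeta| = 1 ->
  `|Ex U p (fun x => zeta ^ (\sum_(s | A s) (u s \subset x)%:Z))| ^+ (2 ^ d) <=
  `|E2 U p (fun x y => zeta ^ (box_deriv d x y))|.
Proof.
move=> p0 p1 z1.
have -> : Ex U p (fun x => zeta ^ (\sum_(s | A s) (u s \subset x)%:Z)) =
          E2 U p (fun x y => zeta ^ (box_deriv 0 x y)).
  apply: eq_Ex => x; rewrite -[LHS](Ex_cst U p); apply: eq_Ex => y; congr (_ ^ _).
  by apply: eq_bigr => s _; rewrite !big_ord0 setD0 mulr1.
apply: (box_norm U p0 p1 (B := B) (D := box_deriv) z1) => m *; [exact: deriv_indep|exact: derivS].
Qed.

Definition hits (V : {set T}) := [forall m : 'I_d, V :&: B m != set0].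

(** Pigeonhole: [d] elements meet [d] disjoint classes. *)
Lemma hits_card (V : {set T}) : #|V| = d -> hits V ->
  V \subset \bigcup_(i < d) B i /\ forall i : 'I_d, #|V :&: B i| = 1%N.
Proof.
move=> Vd /forallP hit.
have dis (i j : 'I_d) : i != j -> [disjoint V :&: B i & V :&: B j].
  move=> ij; apply: disjointWl (subsetIr _ _) _; apply: disjointWr (subsetIr _ _) _.
  exact: Bdis.
have ge1 (i : 'I_d) : (1 <= #|V :&: B i|)%N by rewrite card_gt0.
have tot : #|\bigcup_(i < d) (V :&: B i)| = (\sum_(i < d) #|V :&: B i|)%N.
  by rewrite -sum1_card partition_disjoint_bigcup //; apply: eq_bigr => i _; rewrite sum1_card.
have sub : \bigcup_(i < d) (V :&: B i) \subset V by apply/bigcupsP => i _; apply: subsetIl.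
have dle : (d <= \sum_(i < d) #|V :&: B i|)%N.
  by rewrite -[X in (X <= _)%N](card_ord d) -sum1_card; apply: leq_sum.
have eqV : \bigcup_(i < d) (V :&: B i) = V.
  by apply/eqP; rewrite eqEcard sub tot Vd.
split.
  by rewrite -eqV; apply/bigcupsP => i _; apply: subset_trans (subsetIr _ _) (bigcup_sup i _).
move=> i; apply/eqP; rewrite eqn_leq ge1 andbT.
have : (\sum_(i < d) #|V :&: B i| <= d)%N by rewrite -tot eqV Vd.
rewrite (bigD1 i) //=.
have : (d.-1 <= \sum_(j < d | j != i) #|V :&: B j|)%N.
  have -> : d.-1 = #|[pred j : 'I_d | j != i]|.
    by rewrite -[in LHS](card_ord d) (cardD1 i) inE /=; apply: eq_card => j; rewrite !inE andbT.
  by rewrite -sum1_card; apply: leq_sum.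
by move: (\sum_(j < d | _) _)%N => X; have := ltn_ord i; lia.
Qed.

Lemma deriv_full x y : (forall s, A s -> #|u s| = d) ->
  box_deriv d x y = \sum_(s | A s && hits (u s)) incr (u s) x y.
Proof.
move=> ud; rewrite /box_deriv big_mkcondr; apply: eq_bigr => s As.
case: ifPn => [hit|/forallPn[m]]; last first.
  rewrite negbK => /eqP e; rewrite [X in _ * X](bigD1 m) //= e /mon_diff !sub0set subrr mul0r mulr0 //.
have [sub one] := hits_card (ud _ As) hit.
have -> : u s :\: \bigcup_(i < d) B i = set0 by apply/eqP; rewrite setD_eq0.
rewrite sub0set mul1r /incr.
have {2}-> : u s = \bigcup_(i < d) (u s :&: B i).
  by rewrite -big_distrr /=; apply/esym/setIidPl.
rewrite partition_disjoint_bigcup; last first.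
  move=> i j ij; apply: disjointWl (subsetIr _ _) _; apply: disjointWr (subsetIr _ _) _.
  exact: Bdis.
apply: eq_bigr => i _; have /eqP/cards1P[t ->] := one i.
by rewrite big_set1 /mon_diff !sub1set.
Qed.
End Monomials.

Lemma wt_out (C : numClosedFieldType) (T : finType) (U : {set T}) (p : C) (x : {set T}) :
  ~~ (x \subset U) -> wt U p x = 0.
Proof.
by case/subsetPn=> t tx tU; rewrite /wt (bigD1 t) //= /bern (negPf tU) tx mul0r.
Qed.

Lemma eq_Ex_sub (C : numClosedFieldType) (T : finType) (U : {set T}) (p : C) (f g : {set T} -> C) :
  (forall x : {set T}, x \subset U -> f x = g x) -> Ex U p f = Ex U p g.
Proof.
move=> fg; apply: eq_bigr => x _; have [/fg->//|/wt_out->] := boolP (x \subset U).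
by rewrite !mul0r.
Qed.

Lemma countN_gnp (A : graph) (n : nat) (x : {set 'I_n * 'I_n}) : x \subset upper n ->
  countN A (gnp_graph x) = (\sum_(s : subg_t (Kn n) | is_copy A s) (up_edges s \subset x))%N.
Proof.
move=> /subsetP xU; rewrite -big_mkcondr sum1_card /countN cardsE; apply: eq_card => s.
(* Both hosts have vertex type ['I_n], so they have the same candidate subgraphs, and [sub_iso]
   never reads the adjacency of the host. *)
change (@is_subgraph (gnp_graph x) s && @sub_iso A (Kn n) s =
  (@is_subgraph (Kn n) s && @sub_iso A (Kn n) s) &&
  (up_edges s \subset x)).
rewrite andbAC; congr (_ && _).
apply/is_subgraphP/andP => [h|[/is_subgraphP h /subsetP sx] a b ab].
  split; last first.
    apply/subsetP=> -[a b]; rewrite !inE /= => /andP[/h[axb _ _ _] ab].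
    by case/orP: axb => // /xU; rewrite inE /= ltnNge ltnW.
  apply/is_subgraphP => a b /h[axb aV bV ba]; split=> //.
  by case/orP: axb => /xU; rewrite inE /=; apply: contraTneq => ->; rewrite ltnn.
have [ab_ne aV bV ba] := h _ _ ab; split=> //.
have : a != b :> nat by [].
by rewrite neq_ltn => /orP[lt|lt]; apply/orP; [left|right]; apply: sx; rewrite !inE ?ab ?ba.
Qed.

(** * The character bound for copies of the disjoint union *)

Section CharBound.
Variables (k : nat) (Gs : 'I_k.+1 -> graph) (H : graph) (D : {ffun 'I_k.+1 -> subg_t H}).
Hypothesis simp : forall i, simple (Gs i).
Hypothesis conn : forall i, gconnected (Gs i).
Hypothesis gt1 : forall i, (1 < #|vert (Gs i)|)%N.
Hypotheses (sH : simple H) (cH : gconnected H) (H1 : (1 < #|vert H|)%N).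
Hypothesis pD : path_decomp Gs D.
Notation A := (disj_union Gs).
Notation h := #|vert H|.
Notation d := #|orient (edge_set H)|.

Section Embed.
Variables (n r : nat) (psi : 'I_r -> vert H -> 'I_n).
Hypothesis psi_inj : forall j a j' a', psi j a = psi j' a' -> j = j' /\ a = a'.
Hypothesis psi_mono : forall j a b, (psi j a < psi j b)%N = (enum_rank a < enum_rank b)%N.

(** Indexed by [nat] to fit the iterated difference; the empty default past [d] keeps distinct
    classes disjoint. *)
Definition classes (m : nat) : {set 'I_n * 'I_n} :=
  if insub m is Some c then cls psi (enum_val (c : 'I_d)) else set0.
Definition blocks (i : nat) (j : 'I_r) : {set 'I_n * 'I_n} :=
  if insub i is Some i' then block D psi (i' : 'I_k.+1) j else set0.

Lemma classes_ord (c : 'I_d) : classes c = cls psi (enum_val c).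
Proof. by rewrite /classes valK. Qed.

Lemma blocks_ord (i : 'I_k.+1) j : blocks i j = block D psi i j.
Proof. by rewrite /blocks valK. Qed.

Lemma classes_disjoint m m' : m != m' -> [disjoint classes m & classes m'].
Proof.
rewrite /classes; case: insubP => [c _ <-|_]; last by rewrite -setI_eq0 set0I.
case: insubP => [c' _ <- cc|_ _]; last by rewrite -setI_eq0 setI0.
by apply: (cls_disjoint psi_inj); rewrite (inj_eq enum_val_inj).
Qed.

Lemma blocks_disjoint i j i' j' : (i, j) != (i', j') -> [disjoint blocks i j & blocks i' j'].
Proof.
rewrite /blocks; case: insubP => [c _ <-|_]; last by rewrite -setI_eq0 set0I.
case: insubP => [c' _ <- cc|_ _]; last by rewrite -setI_eq0 setI0.
exact: (block_disjoint pD psi_inj).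
Qed.

Lemma copy_hits_spread (s : subg_t (Kn n)) :
  is_copy A s && hits d classes (up_edges s) =
  (s \in [set spread D psi (f : {ffun 'I_k.+1 -> 'I_r}) | f in {ffun 'I_k.+1 -> 'I_r} & proper_col f]).
Proof.
apply/andP/imsetP => [[cs hs]|[f]].
  have cd := card_up_copy sH pD cs.
  have [sub _] := hits_card classes_disjoint cd hs.
  have [|| f pf ->] := copy_spread simp conn gt1 sH cH H1 pD psi_inj cs.
  - move=> e eE; have /forallP/(_ (enum_rank_in eE e)) := hs.
    by rewrite classes_ord enum_rankK_in.
  - apply: subset_trans sub _; apply/bigcupsP => i _; rewrite classes_ord.
    by apply: (bigcup_sup (enum_val i)); apply: enum_valP.
  by exists f; rewrite ?inE.
rewrite inE => /= pf ->; split; first exact: (spread_copy sH pD psi_inj).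
apply/forallP => m; rewrite classes_ord; apply: (spread_hits pD psi_mono).
exact: enum_valP.
Qed.

Lemma deriv_path_sum x y :
  box_deriv (is_copy A (n := n)) (@up_edges n) classes d x y = path_sum k blocks x y.
Proof.
rewrite deriv_full; first last.
- by move=> s; apply: (card_up_copy sH pD).
- exact: classes_disjoint.
rewrite (eq_bigl _ _ copy_hits_spread) big_imset /=; last first.
  by move=> f f' _ _; apply: (spread_inj conn gt1 sH pD psi_inj psi_mono).
rewrite /path_sum; apply: eq_big => f; first by rewrite inE.
move=> _; rewrite up_spread // /incr partition_disjoint_bigcup.
  by apply: eq_bigr => i _; rewrite blocks_ord.
move=> i i' ii; apply: (block_disjoint pD psi_inj).
by rewrite xpair_eqE negb_and ii.
Qed.
End Embed.

Variables (C : numClosedFieldType) (p : C) (q : nat) (zeta delta : C).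
Hypotheses (p0 : 0 < p) (p1 : p < 1).
Hypotheses (q0 : (0 < q)%N) (zq : zeta ^+ q = 1) (z1 : zeta != 1).
Hypotheses (de0 : 0 < delta) (de1 : delta <= 1).
Hypothesis zde : forall n : int, zeta ^ n != 1 -> `|1 + zeta ^ n| <= 2 - delta.

Lemma char_bound n :
  `|Ex (upper n) p (fun x => zeta ^+ (countN A (gnp_graph x)))| ^+ (2 ^ d) <=
  q%:R ^+ k * (1 - ((p * (1 - p)) ^+ d ^+ 2) ^+ 2 * delta) ^+ (n %/ h).
Proof.
set r := (n %/ h)%N.
have lt (j : 'I_r) (a : vert H) : (j * h + enum_rank a < n)%N.
  have := ltn_ord j; have := ltn_ord (enum_rank a); have := leq_trunc_div n h.
  rewrite -/r; move: (enum_rank a : nat) (j : nat) => u v; rewrite -[in X in (_ < X)%N -> _](card_ord h).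
  rewrite card_ord => le1 lt1 lt2; apply: leq_trans le1.
  have : (v.+1 * h <= r * h)%N by rewrite leq_mul2r lt2 orbT.
  by rewrite mulSn; lia.
(* Copy [j] occupies the [j]-th interval of length [h], with its vertices in the order of
   [enum_rank]. *)
pose psi j a : 'I_n := Ordinal (lt j a).
have psi_inj j a j' a' : psi j a = psi j' a' -> j = j' /\ a = a'.
  move/(congr1 val) => /= e.
  have la := ltn_ord (enum_rank a); have la' := ltn_ord (enum_rank a').
  have h0 : (0 < h)%N by apply: ltnW.
  have ej : j = j'.
    apply: val_inj => /=; have := congr1 (divn^~ h) e.
    by rewrite /= !divnMDl // !divn_small ?addn0.
  split=> //; apply: enum_rank_inj; apply: val_inj.
  by move: e; rewrite ej => /addnI.
have psi_mono j a b : (psi j a < psi j b)%N = (enum_rank a < enum_rank b)%N.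
  by rewrite /= ltn_add2l.
have zn1 := norm_unity_root q0 zq.
have := box_norm_count (is_copy A (n := n)) (@up_edges n) d
  (@classes_disjoint n r psi psi_inj) (upper n) p0 p1 zn1.
have -> : Ex (upper n) p (fun x => zeta ^ (\sum_(s | is_copy A s) (up_edges s \subset x)%:Z)) =
   Ex (upper n) p (fun x => zeta ^+ (countN A (gnp_graph x))).
  apply: eq_Ex_sub => x xU.
  rewrite countN_gnp // exprnP; congr (_ ^ _).
  by rewrite (big_morph Posz PoszD (erefl _)).
move/le_trans; apply.
have -> : E2 (upper n) p (fun x y =>
     zeta ^ box_deriv (is_copy A (n := n)) (@up_edges n) (classes psi) d x y) =
   E2 (upper n) p (fun x y => zeta ^ path_sum k (blocks psi) x y).
  by apply: eq_E2 => x y; rewrite deriv_path_sum.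
apply: (path_sum_bound p0 p1 (W := blocks psi) (d := d)) => //.
- by move=> i j i' j'; apply: blocks_disjoint.
- move=> i j; rewrite /blocks; case: insubP => [c _ _|_]; last exact: sub0set.
  exact: block_upper.
- move=> i j ik; rewrite (blocks_ord _ (Ordinal (ik : (i < k.+1)%N))).
  exact: (block_neq0 conn gt1 sH pD).
- move=> j; apply: leq_trans (block_card pD psi j).
  by apply/subset_leq_card/bigcupsP => i _; rewrite blocks_ord; apply: (bigcup_sup i).
Qed.
End CharBound.

(** * Residues *)

Lemma closed_prim_root (C : numClosedFieldType) (q : nat) : (0 < q)%N ->
  exists w : C, q.-primitive_root w.
Proof.
move=> q0; have [r] := closed_field_poly_normal ('X^q - 1 : {poly C}).
rewrite (monicP (monicXnsubC _ q0)) scale1r => fact.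
suff /hasP[w _ pw] : has q.-primitive_root r by exists w.
apply: has_prim_root => //.
- by apply/allP => z; rewrite -root_prod_XsubC -fact.
- rewrite -separable_prod_XsubC -fact separable_Xn_sub_1 //.
  by rewrite pnatr_eq0 -lt0n.
- by have := size_prod_XsubC r id; rewrite -fact size_XnsubC // => -[->].
Qed.

Section Roots.
Variables (C : numClosedFieldType) (q : nat) (w : C).
Hypotheses (q0 : (0 < q)%N) (pw : q.-primitive_root w).

Lemma norm_prim : `|w| = 1.
Proof. exact: norm_unity_root q0 (prim_expr_order pw). Qed.

(** Equality in the triangle inequality would force equal directions, and both terms have modulus
    1. *)
Lemma norm1_add_lt2 (x : C) : `|x| = 1 -> x != 1 -> `|1 + x| < 2.
Proof.
move=> x1 xn; rewrite lt_neqAle; apply/andP; split; last first.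
  by apply: le_trans (ler_normD _ _) _; rewrite normr1 x1.
apply: contra_neq xn => e.
have : `|1 + x| = `|1 : C| + `|x| by rewrite e normr1 x1.
by case/normCDeq => t t1 [e1 e2]; rewrite normr1 x1 mul1r in e1 e2; rewrite e2 -e1.
Qed.

Lemma roots_gap : exists delta : C, [/\ 0 < delta, delta <= 1 &
  forall n : int, w ^ n != 1 -> `|1 + w ^ n| <= 2 - delta].
Proof.
have n1 m : `|w ^+ m| = 1 by rewrite normrX norm_prim expr1n.
pose g (m : 'I_q) : C := if w ^+ m == 1 then 1 else (2 - `|1 + w ^+ m|) / 2.
have g01 m : 0 < g m <= 1.
  rewrite /g; case: ifPn => [_|mn]; first by rewrite ltr01 lexx.
  rewrite divr_gt0 ?subr_gt0 ?norm1_add_lt2 // ler_pdivrMr // mul1r.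
  by rewrite lerBlDr lerDl normr_ge0.
(* Finitely many gaps in [(0, 1]] have their product as a common positive lower bound. Halving in
   [g] keeps each at most 1, and trivial powers get the neutral value 1. *)
exists (\prod_m g m); split; first by apply: prodr_gt0 => m _; case/andP: (g01 m).
  by apply: prodr_ile1 => m _; case/andP: (g01 m) => /ltW-> ->.
move=> n wn; have w0 : w != 0 by rewrite -normr_eq0 norm_prim oner_neq0.
have lt : (`|(n %% q)%Z| < q)%N by rewrite -ltz_nat gez0_abs ?modz_ge0 ?ltz_pmod // -lt0n.
have e : w ^ n = w ^+ (Ordinal lt).
  rewrite /= exprnP gez0_abs ?modz_ge0 -?lt0n // {1}(divz_eq n q) expfzDr // [(_ * q%:Z)%R]mulrC.
  by rewrite -exprz_exp -exprnP (prim_expr_order pw) exp1rz mul1r.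
rewrite e in wn *; set m := Ordinal lt in wn *.
rewrite lerBrDr -lerBrDl; apply: (@le_trans _ _ (g m)).
  rewrite (bigD1 m) //=; apply: ler_piMr; first by case/andP: (g01 m) => /ltW.
  by apply: prodr_ile1 => i _; case/andP: (g01 i) => /ltW-> ->.
rewrite /g (negPf wn) ler_pdivrMr // ler_peMr ?ler1n // subr_ge0.
by apply: ltW; apply: norm1_add_lt2.
Qed.

Lemma sum_prim (m : nat) : \sum_(a < q) w ^+ (a * m) = if (q %| m)%N then q%:R else 0.
Proof.
under eq_bigr do rewrite mulnC exprM.
case: ifPn => [qm|qm].
  rewrite (eq_bigr (fun=> 1)) ?sumr_const ?card_ord // => a _.
  by move: qm; rewrite (prim_order_dvd pw) => /eqP->; rewrite expr1n.
have wm : w ^+ m - 1 != 0 by rewrite subr_eq0 -(prim_order_dvd pw).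
apply: (mulfI wm); rewrite mulr0 -subrX1 -exprM mulnC exprM (prim_expr_order pw).
by rewrite expr1n subrr.
Qed.

Variables (T : finType) (U : {set T}) (p : C).
Hypotheses (p0 : 0 < p) (p1 : p < 1).

(** Fourier inversion on [Z_q]: frequency 0 contributes exactly [1 / q], and the weight [1 / q]
    balances the number of the others. As the bounds concern [M]-th powers, their [M]-th roots are
    added. *)
Lemma residue_bound (N : {set T} -> nat) (Y : C) (M r : nat) : (r < q)%N -> (0 < M)%N ->
  (forall a, w ^+ a != 1 -> `|Ex U p (fun x => (w ^+ a) ^+ (N x))| ^+ M <= Y) -> 0 <= Y ->
  `|Ex U p (fun x => (N x %% q == r)%N%:R) - q%:R^-1| ^+ M <= Y.
Proof.
move=> rq M0 bnd Y0.
have qn0 : q%:R != 0 :> C by rewrite pnatr_eq0 -lt0n.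
(* [q - r] stands for [- r] modulo [q], which keeps the exponents natural. *)
have e x : (N x %% q == r)%N%:R = q%:R^-1 * \sum_(a < q) w ^+ (a * (q - r)) * (w ^+ a) ^+ N x :> C.
  rewrite (eq_bigr (fun a : 'I_q => w ^+ (a * (q - r + N x)))) => [|a _]; last first.
    by rewrite -exprM -exprD mulnDr.
  rewrite sum_prim; have -> : (q %| q - r + N x)%N = (N x %% q == r)%N.
    rewrite (addnBAC _ (ltnW rq)) -eqn_mod_dvd; last by apply: leq_trans (ltnW rq) (leq_addr _ _).
    by rewrite modnDl (modn_small rq).
  by case: ifP => _; rewrite ?mulVf ?mulr0.
have -> : Ex U p (fun x => (N x %% q == r)%N%:R) - q%:R^-1 =
   q%:R^-1 * \sum_(a < q | a != Ordinal q0) w ^+ (a * (q - r)) * Ex U p (fun x => (w ^+ a) ^+ N x).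
  rewrite (eq_Ex _ _ e) ExZ Ex_sum (bigD1 (Ordinal q0)) //= mulrDr.
  rewrite (@eq_Ex _ _ U p _ (fun=> 1)) => [|x]; last by rewrite mul0n expr0 mul1r expr1n.
  rewrite Ex_cst mulr1 addrC addKr; congr (_ * _); apply: eq_bigr => a _.
  by rewrite ExZ.
have root0 : 0 <= M.-root Y by rewrite rootC_ge0.
apply: (@le_trans _ _ (M.-root Y ^+ M)); last by rewrite rootCK.
apply: lerXn2r; rewrite ?nnegrE ?normr_ge0 //.
rewrite normrM normfV normr_nat mulrC ler_pdivrMr ?ltr0n //.
apply: le_trans (ler_norm_sum _ _ _) _.
apply: (@le_trans _ _ (\sum_(a < q) M.-root Y)); last first.
  by rewrite sumr_const card_ord mulr_natr.
rewrite big_mkcond; apply: ler_sum => a _; case: ifPn => // a0.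
rewrite normrM normrX norm_prim expr1n mul1r.
rewrite -(ler_pXn2r M0) ?nnegrE ?normr_ge0 // rootCK //.
apply: bnd; rewrite -(prim_order_dvd pw); apply: contra a0 => /dvdn_leq.
rewrite -val_eqE /=; case: (a : nat) (ltn_ord a) => // a' lt /(_ isT).
by rewrite leqNgt lt.
Qed.
End Roots.

Lemma wt_sub (C : numClosedFieldType) (T : finType) (U : {set T}) (p : C) (x : {set T}) :
  x \subset U -> wt U p x = p ^+ #|x| * (1 - p) ^+ (#|U| - #|x|).
Proof.
move=> xU; rewrite /wt (bigID (fun t => t \in U)) /= [X in _ * X]big1 ?mulr1 => [|t tU]; last first.
  rewrite /bern (negPf tU); case: (boolP (t \in x)) => [/(subsetP xU)|//].
  by rewrite (negPf tU).
rewrite (bigID (fun t => t \in x)) /=; congr (_ * _).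
  rewrite -prodr_const; apply: eq_big => t; last by move=> /andP[tU tx]; rewrite /bern tU tx.
  by case: (boolP (t \in x)) => [/(subsetP xU)->|]; rewrite ?andbF.
have -> : (#|U| - #|x| = #|U :\: x|)%N by rewrite cardsD (setIidPr xU).
rewrite -prodr_const; apply: eq_big => t; first by rewrite inE andbC.
by move=> /andP[tU tx]; rewrite /bern tU (negPf tx).
Qed.

(** * From complex averages to real probabilities *)

Local Notation C := (complex R).
Local Notation "x %:C" := (real_complex R x) : ring_scope.

Lemma prob_mod_Ex (A : graph) (n : nat) (p : R) (q r : nat) :
  (prob_mod A n p q r)%:C =
  Ex (upper n) (p%:C : C) (fun x => (countN A (gnp_graph x) %% q == r)%N%:R).
Proof.
have -> : prob_mod A n p q r =
  \sum_(E : {set 'I_n * 'I_n} | (E \in powerset (upper n)) && (countN A (gnp_graph E) %% q == r)%N)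
     gnp_weight p E by [].
rewrite rmorph_sum /= /Ex big_mkcond; apply: eq_bigr => x _; rewrite powersetE.
have [xU|/wt_out->] /= := boolP (x \subset upper n); last by rewrite mul0r.
case: eqP => _; rewrite ?mulr0 // mulr1 wt_sub // /gnp_weight.
by rewrite !RpowE !rmorphM /= !rmorphXn /= rmorphB rmorph1.
Qed.

Lemma norm_real_complex (x : R) : `|x%:C| = `|x|%:C.
Proof. by rewrite normc_def /= expr0n addr0 sqrtr_sqr. Qed.

Lemma residue_decay (k : nat) (Gs : 'I_k.+1 -> graph) (H : graph)
    (D : {ffun 'I_k.+1 -> subg_t H}) (p : R) (q : nat) :
  (forall i, simple (Gs i)) -> (forall i, gconnected (Gs i)) ->
  (forall i, (1 < #|vert (Gs i)|)%N) ->
  simple H -> gconnected H -> (1 < #|vert H|)%N -> path_decomp Gs D ->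
  0 < p -> p < 1 -> (1 < q)%N ->
  exists (M h : nat) (K rho : R), [/\ (0 < M)%N, (0 < h)%N, 0 <= K, 0 < rho < 1 &
    forall n r, (r < q)%N ->
      `|prob_mod (disj_union Gs) n p q r - q%:R^-1| ^+ M <= K * rho ^+ (n %/ h)].
Proof.
move=> simp conn gt1 sH cH H1 pD p0 p1 q1.
have q0 : (0 < q)%N by apply: ltnW.
have [w pw] := closed_prim_root C q0.
have [[dl di] [de0 de1 gap]] := roots_gap q0 pw.
(* Positivity in the order of the complex numbers includes being real, so the gap descends to the
   reals. *)
have di0 : di = 0 by move: de0; rewrite ltcE => /andP[/eqP].
subst di; rewrite complexr0 in de0 de1 gap.
have dl0 : 0 < dl by rewrite -ltcR.
have dl1 : dl <= 1 by rewrite -lecR.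
set d := #|orient (edge_set H)|.
pose b : R := ((p * (1 - p)) ^+ d ^+ 2) ^+ 2.
have b0 : 0 < b by rewrite !exprn_gt0 // mulr_gt0 // subr_gt0.
have b1 : b <= 1.
  have pq0 : 0 <= p * (1 - p) by rewrite mulr_ge0 ?subr_ge0 ?ltW.
  have pq1 : p * (1 - p) <= 1 by rewrite mulr_ile1 ?subr_ge0 ?ltW // ltrBlDr ltrDl.
  by rewrite !exprn_ile1 ?exprn_ge0.
pose rho0 : R := 1 - b * dl.
have r0 : 0 <= rho0 by rewrite subr_ge0 mulr_ile1 // ltW.
have r1 : rho0 < 1 by rewrite ltrBlDr ltrDl mulr_gt0.
(* [rho0] is only known to be nonnegative, while the decay estimate needs a positive base below 1;
   the midpoint between [rho0] and 1 is one. *)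
have [r_lt lt_1] := midf_lt r1.
exists (2 ^ d)%N, #|vert H|, (q%:R ^+ k), ((rho0 + 1) / 2); split.
- by rewrite expn_gt0.
- exact: ltnW.
- by rewrite exprn_ge0.
- by rewrite lt_1 (le_lt_trans r0).
move=> n r rq; apply: (@le_trans _ _ (q%:R ^+ k * rho0 ^+ (n %/ #|vert H|))); last first.
  rewrite ler_wpM2l ?exprn_ge0 // lerXn2r ?nnegrE ?(ltW r_lt) //.
  exact: le_trans r0 (ltW r_lt).
have p0c : 0 < p%:C :> C by rewrite ltcR.
have p1c : p%:C < 1 :> C by rewrite ltcR.
have := @residue_bound C q w q0 pw _ (upper n) p%:C (fun x => countN (disj_union Gs) (gnp_graph x))
   (q%:R ^+ k * rho0 ^+ (n %/ #|vert H|))%:C (2 ^ d) r rq.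
rewrite expn_gt0 /= -prob_mod_Ex => /(_ isT) bnd.
suff : `|(prob_mod (disj_union Gs) n p q r)%:C - q%:R^-1| ^+ (2 ^ d) <=
    (q%:R ^+ k * rho0 ^+ (n %/ #|vert H|))%:C :> C.
  have -> : (q%:R^-1 : C) = (q%:R^-1)%:C by rewrite fmorphV rmorph_nat.
  by rewrite -rmorphB /= norm_real_complex -rmorphXn /= lecR.
apply: bnd => [a wa|].
  have := @char_bound k Gs H D simp conn gt1 sH cH H1 pD C p%:C q (w ^+ a) dl%:C p0c p1c q0 _ wa de0 de1.
  rewrite exprAC (prim_expr_order pw) expr1n => /(_ erefl) cb.
  apply: le_trans (cb _ n) _; first by move=> m; rewrite exprnP exprz_exp; apply: gap.
  rewrite rmorphM !rmorphXn /= rmorph_nat rmorphB /= rmorph1 rmorphM /= !rmorphXn /= rmorphM /=.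
  by rewrite rmorphB /= rmorph1.
by rewrite lecR mulr_ge0 ?exprn_ge0.
Qed.

Theorem mainTheorem11 (k : nat) (Gs : 'I_k -> graph) :
  (2 <= k)%N ->
  (forall i, simple (Gs i)) ->
  (forall i, gconnected (Gs i)) ->
  (forall i j : 'I_k, i != j -> ~ iso_to_subgraph (Gs i) (Gs j)) ->
  (exists H : graph, tree_like Gs H /\ forall i, ~ giso H (Gs i)) /\
  (forall (p : R) (q : nat), Rlt 0 p -> Rlt p 1 -> (1 < q)%N ->
     exists c : R, Rlt 0 c /\
       exists n0 : nat, forall n : nat, (n0 <= n)%N ->
         Rle (tv_mod_uniform (disj_union Gs) n p q) (Rpower 2 (- (c * INR n)))).
Proof.
move=> k2 simp conn inc; have gt1 := incomparable_card_gt1 k2 simp conn inc.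
have [H [D [sH cH pD]]] := path_gluing k2 simp conn inc.
split.
  exists H; split; first by apply: path_decomp_tree_like pD => //; apply: ltnW.
  exact: path_decomp_not_iso pD.
move=> p q /RltP p0 /RltP p1 q1.
have H1 : (1 < #|vert H|)%N.
  case: k Gs k2 simp conn inc gt1 D pD => // k Gs k2 simp conn inc gt1 D [[/(_ ord0)/andP[_ si] _ _] _ _ _].
  apply: leq_trans (gt1 ord0) _; rewrite -(sub_iso_card_vert si); exact: max_card.
case: k Gs k2 simp conn inc gt1 D pD => // k Gs k2 simp conn inc gt1 D pD.
have [M [h [K [rho [M0 h0 K0 /andP[r0 r1] bnd]]]]] :=
  residue_decay simp conn gt1 sH cH H1 pD p0 p1 q1.
have q0 : (0 < q)%N by apply: ltnW.
have [c [c0 [n0 n0P]]] := exp_decay M0 h0 q0 (elimT RltP r0) (elimT RltP r1) (elimT RleP K0).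
exists c; split=> //; exists n0 => n nn.
have le r : (r < q)%N -> `|prob_mod (disj_union Gs) n p q r - q%:R^-1| <= Rpower 2 (- (c * INR n)) / q%:R.
  move=> rq; apply/RleP; rewrite -INRE; apply: (n0P n nn); first by apply/RleP; rewrite normr_ge0.
  by apply/RleP; rewrite !RpowE INRE; apply: bnd.
have E0 : 0 <= Rpower 2 (- (c * INR n)) by apply/RleP/Rlt_le/exp_pos.
have tvE : tv_mod_uniform (disj_union Gs) n p q =
    2^-1 * \sum_(r < q) `|prob_mod (disj_union Gs) n p q r - q%:R^-1|.
  rewrite /tv_mod_uniform; congr (_ * _); apply: eq_bigr => r _.
  by rewrite RabsE INRE.
apply/RleP; rewrite tvE.
(* The factor one half of the total variation distance is given away; the [q] residues share the
   bound equally. *)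
apply: (@le_trans _ _ (2^-1 * Rpower 2 (- (c * INR n)))); last first.
  by rewrite ler_piMl // invf_le1 // ler1n.
rewrite ler_pM2l ?invr_gt0 //.
apply: (@le_trans _ _ (\sum_(r < q) Rpower 2 (- (c * INR n)) / q%:R)).
  by apply: ler_sum => r _; apply: le.
by rewrite sumr_const card_ord -[leLHS]mulr_natr divfK // pnatr_eq0 -lt0n //.
Qed.
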